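(* Let $M$ and $A$ be the mass and stiffness matrices described in the context and let $\Delta t>0$ be the time step. Assume that the eigenvalues of the coefficient matrix $\Gamma\in\mathbb{R}^{s\times s}$ of a given implicit Runge--Kutta (RK) method have nonnegative real parts, and that the RK stage system $$M\boldsymbol{v}_k+\Delta t\,A\sum_{j=1}^s\gamma_{kj}\boldsymbol{v}_j=-A\boldsymbol{u}^n,\qquad k=1,\dots,s,$$ is solved by using the (real) Jordan normal form of $\Gamma$ to transform it into smaller systems. Then the conditioning of the implicit RK integration of $M\,\frac{d\boldsymbol{u}}{dt}=-A\boldsymbol{u}$ is determined by the conditioning of $$M+\mu_j\Delta t\,A\qquad\text{and}\qquad I_2\otimes M+\Delta t\,C_j\otimes A,\qquad C_j=\begin{bmatrix}\alpha_j&\beta_j\\-\beta_j&\alpha_j\end{bmatrix},$$ where $\mu_j$ and $\alpha_j\pm i\beta_j$ are the real and complex eigenvalues of $\Gamma$, respectively. Moreover, for any symmetric and positive definite preconditioner $P$, $$\tilde\kappa\left((I_2\otimes P^{-\frac12})(I_2\otimes M+\Delta t\,C_j\otimes A)(I_2\otimes P^{-\frac12})\right)\le\frac{\lambda_{\max}(P^{-\frac12}MP^{-\frac12})+\Delta t\sqrt{\alpha_j^2+\beta_j^2}\;\lambda_{\max}(P^{-\frac12}AP^{-\frac12})}{\lambda_{\min}(P^{-\frac12}MP^{-\frac12})+\Delta t\,\alpha_j\,\lambda_{\min}(P^{-\frac12}AP^{-\frac12})}.$$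
   Context: $\otimes$ is the Kronecker product, $I_n$ the $n\times n$ identity, $\sigma_{\max}$ the largest singular value, and $\lambda_{\min},\lambda_{\max}$ the extremal eigenvalues of a symmetric matrix. For a real square matrix $\mathbb{B}$ whose symmetric part is positive definite, the ''condition number'' used is $\tilde\kappa(\mathbb{B})=\sigma_{\max}(\mathbb{B})/\lambda_{\min}((\mathbb{B}+\mathbb{B}^T)/2)$, which for symmetric positive definite matrices is the standard condition number in the 2-norm. $\Gamma=(\gamma_{kj})_{k,j=1}^s$ is the coefficient matrix of an $s$-stage implicit RK method; the stage system has coefficient matrix $I_s\otimes M+\Delta t\,\Gamma\otimes A$, and $\boldsymbol{u}^n$ is the approximation at the current time level. Real Jordan normal form: $\Gamma=T\,\mathrm{diag}(J_1,\dots,J_p)\,T^{-1}$, where $T$ is a real invertible matrix and each Jordan block $J_j$ is either an upper bidiagonal matrix with a real eigenvalue $\mu_j$ on the diagonal and $1$ on the superdiagonal, or a block upper bidiagonal matrix with the $2\times2$ blocks $C_j$ ($\alpha_j,\beta_j\in\mathbb{R}$) on the diagonal and $I_2$ on the block superdiagonal. By the assumption on the eigenvalues of $\Gamma$, $\mu_j,\alpha_j\ge0$. $M_{kj}=\int_\Omega\phi_k\phi_j\,d\boldsymbol{x}$ and $A_{kj}=\int_\Omega\nabla\phi_k\cdot\mathbb{D}\nabla\phi_j\,d\boldsymbol{x}$, $k,j=1,\dots,N_{vi}$, where $\Omega\subset\mathbb{R}^d$ is a bounded polygonal or polyhedral domain, $\mathbb{D}(\boldsymbol{x})$ is symmetric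 with $d_{\min}I\le\mathbb{D}(\boldsymbol{x})\le d_{\max}I$ on $\Omega$ for some $d_{\min},d_{\max}>0$, and $\phi_j$ are the continuous piecewise linear nodal basis functions of the $N_{vi}$ interior vertices of a simplicial mesh of $\Omega$ (homogeneous Dirichlet conditions). The preconditioner $P$ is an $N_{vi}\times N_{vi}$ matrix. *)

(* Defs.v *)
From HB Require Import structures.
From mathcomp Require Import all_boot all_order all_algebra.
From mathcomp Require Import all_classical all_reals all_analysis.
From mathcomp Require Import complex mxtens.

Set Implicit Arguments.
Unset Strict Implicit.
Unset Printing Implicit Defensive.

Import Order.TTheory GRing.Theory Num.Theory.
Import numFieldNormedType.Exports.

Local Open Scope classical_set_scope.
Local Open Scope ring_scope.

Section measurable_rV.
Context {R : realType} {d : nat}.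

Definition rV_coord (i : 'I_d) (x : 'rV[R]_d) : R := x ord0 i.

Let rV_set0 : g_sigma_preimage rV_coord set0.
Proof. exact: sigma_algebra0. Qed.

Let rV_setC A : g_sigma_preimage rV_coord A -> g_sigma_preimage rV_coord (~` A).
Proof. exact: sigma_algebraC. Qed.

Let rV_bigcup (F : (set 'rV[R]_d)^nat) :
  (forall i, g_sigma_preimage rV_coord (F i)) ->
  g_sigma_preimage rV_coord (\bigcup_i F i).
Proof. exact: sigma_algebra_bigcup. Qed.

(* The sigma-algebra generated by the coordinates, i.e. the Borel one. *)
HB.instance Definition _ := @isMeasurable.Build default_measure_display
  'rV[R]_d (g_sigma_preimage rV_coord) rV_set0 rV_setC rV_bigcup.

Lemma measurable_rV_coord i : measurable_fun setT (rV_coord i).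
Proof.
move=> _ Y mY; rewrite setTI; apply: sub_sigma_algebra => /=.
rewrite -bigcup_seq/=; exists i => /=; first by rewrite mem_index_enum.
by exists Y => //; rewrite setTI.
Qed.

Lemma measurable_fun_rVP d1 (T1 : measurableType d1) (f : T1 -> 'rV[R]_d) :
  (forall i, measurable_fun setT (rV_coord i \o f)) -> measurable_fun setT f.
Proof.
move=> mf _ A mA; rewrite setTI.
suff : g_sigma_preimage (fun i => rV_coord i \o f) `<=` measurable.
  apply; rewrite g_sigma_preimage_comp; exists A => //.
  by rewrite setTI.
apply: smallest_sub; first exact: sigma_algebra_measurable.
by apply: (big_ind (fun G => G `<=` measurable)) => //=[*|i _ B [C mC <-]];
  [rewrite subUset|exact: mf].
Qed.

End measurable_rV.

Section lebesgue_measure_rV.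
Context {R : realType}.

Definition rV_cons d (p : measurableTypeR R * 'rV[R]_d) : 'rV[R]_d.+1 :=
  \row_i if unlift ord0 i is Some j then p.2 ord0 j else p.1.

Lemma measurable_rV_cons d : measurable_fun setT (@rV_cons d).
Proof.
apply: measurable_fun_rVP => i.
case: (unliftP ord0 i) => [j ->|->].
- rewrite (_ : _ \o _ = rV_coord j \o snd); last first.
    by apply/funext => p /=; rewrite /rV_coord mxE liftK.
  by apply: measurableT_comp => //; exact: measurable_rV_coord.
- rewrite (_ : _ \o _ = fst) //.
  by apply/funext => p /=; rewrite /rV_coord mxE unlift_none.
Qed.

Definition rV_uncons d (x : 'rV[R]_d.+1) : measurableTypeR R * 'rV[R]_d :=
  (x ord0 ord0, \row_j x ord0 (lift ord0 j)).

Lemma measurable_rV_uncons d : measurable_fun setT (@rV_uncons d).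
Proof.
apply: measurable_fun_pair; first exact: (measurable_rV_coord ord0).
apply: measurable_fun_rVP => i.
rewrite (_ : _ \o _ = rV_coord (lift ord0 i)); first exact: measurable_rV_coord.
by apply/funext => x /=; rewrite /rV_coord mxE.
Qed.

Lemma rV_consK d : cancel (@rV_cons d) (@rV_uncons d).
Proof.
move=> [a v]; rewrite /rV_uncons mxE unlift_none; congr pair.
by apply/rowP => j; rewrite !mxE liftK.
Qed.

Section step.
Context {d : nat} (mu : {sigma_finite_measure set 'rV[R]_d -> \bar R}).

Definition lebesgue_rV_step : set 'rV[R]_d.+1 -> \bar R :=
  pushforward (lebesgue_measure \x mu)%E (@rV_cons d).

Let step0 : lebesgue_rV_step set0 = 0%E.
Proof. by rewrite /lebesgue_rV_step /pushforward preimage_set0 measure0. Qed.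

Let step_ge0 A : (0 <= lebesgue_rV_step A)%E.
Proof. by rewrite /lebesgue_rV_step /pushforward; exact: measure_ge0. Qed.

Let step_sigma_additive : semi_sigma_additive lebesgue_rV_step.
Proof.
move=> F mF tF mUF; rewrite /lebesgue_rV_step /pushforward preimage_bigcup.
have mcons A : measurable A -> measurable (@rV_cons d @^-1` A).
  by move=> mA; rewrite -[X in measurable X]setTI; exact: measurable_rV_cons.
apply: measure_semi_sigma_additive.
- by move=> n; exact: mcons.
- apply/trivIsetP => /= i j _ _ ij; rewrite -preimage_setI.
  by move/trivIsetP : tF => /(_ _ _ _ _ ij) ->//; rewrite preimage_set0.
- by rewrite -preimage_bigcup; exact: mcons.
Qed.

HB.instance Definition _ := isMeasure.Build _ _ _ lebesgue_rV_step
  step0 step_ge0 step_sigma_additive.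

Let step_sigma_finite : sigma_finite setT lebesgue_rV_step.
Proof.
have /sigma_finiteP[F [TF ndF Foo]] := sigma_finiteT (@lebesgue_measure R).
have /sigma_finiteP[G [TG ndG Goo]] := sigma_finiteT mu.
exists (fun n => @rV_uncons d @^-1` (F n `*` G n)).
  rewrite -preimage_bigcup; apply/esym/seteqP; split => // x _.
  have [n _ Fn] : (\bigcup_n F n) (rV_uncons x).1 by rewrite -TF.
  have [k _ Gk] : (\bigcup_n G n) (rV_uncons x).2 by rewrite -TG.
  exists (maxn n k) => //; split.
  - by move: Fn; exact/subsetPset/ndF/leq_maxl.
  - by move: Gk; exact/subsetPset/ndG/leq_maxr.
move=> k; have [mF Fk] := Foo k; have [mG Gk] := Goo k; split.
  rewrite -[X in measurable X]setTI; apply: measurable_rV_uncons => //.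
  exact: measurableX.
rewrite /lebesgue_rV_step /pushforward -comp_preimage.
rewrite (_ : _ \o _ = id); last exact/funext/rV_consK.
by rewrite preimage_id product_measure1E // lte_mul_pinfty // ge0_fin_numE.
Qed.

HB.instance Definition _ := Measure_isSigmaFinite.Build _ _ _ lebesgue_rV_step
  step_sigma_finite.

End step.

Fixpoint lebesgue_rV d : {sigma_finite_measure set 'rV[R]_d -> \bar R} :=
  match d with
  | 0 => \d_(0 : 'rV[R]_0)
  | d'.+1 => lebesgue_rV_step (lebesgue_rV d')
  end.

Lemma lebesgue_rV_box d (I : 'I_d -> set R) : (forall i, measurable (I i)) ->
  lebesgue_rV d [set x | forall i, I i (x ord0 i)] =
  (\prod_(i < d) lebesgue_measure (I i))%E.
Proof.
elim: d I => [|d IH] I mI.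
  by rewrite big_ord0 /= diracE mem_set //= => -[].
rewrite big_ord_recl -IH //= /lebesgue_rV_step /pushforward.
have -> : @rV_cons d @^-1` [set x | forall i, I i (x ord0 i)] = I ord0 `*`
    [set x : 'rV[R]_d | forall i : 'I_d, I (lift ord0 i) (x ord0 i)].
  apply/seteqP; split => -[a v] /=.
    move=> H; split; first by have := H ord0; rewrite mxE unlift_none.
    by move=> i; have := H (lift ord0 i); rewrite mxE liftK.
  by move=> [Ia Iv] i; rewrite mxE; case: unliftP => [j ->|->].
rewrite product_measure1E //; first exact: mI.
rewrite (_ : [set x | _] =
  \bigcap_(i in [set: 'I_d]) (rV_coord i @^-1` I (lift ord0 i))).
  apply: fin_bigcap_measurable => // i _; rewrite -[X in measurable X]setTI.
  by apply: measurable_rV_coord => //; exact: mI.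
by apply/seteqP; split => x /= H i; [move=> _|]; exact: H.
Qed.

End lebesgue_measure_rV.

Section matrix_notions.
Context {R : realType}.

Definition posdef n (A : 'M[R]_n) :=
  forall x : 'cV[R]_n, x != 0 -> 0 < (x^T *m A *m x) 0 0.

Definition spd n (A : 'M[R]_n) := A^T = A /\ posdef A.

Definition loewner_le n (A B : 'M[R]_n) :=
  forall x : 'cV[R]_n, (x^T *m A *m x) 0 0 <= (x^T *m B *m x) 0 0.

(* For symmetric matrices of positive size, the set of (real) eigenvalues is
   finite and nonempty, so that sup and inf are a maximum and a minimum. *)
Definition lambda_max n (A : 'M[R]_n) : R := sup [set a | eigenvalue A a].
Definition lambda_min n (A : 'M[R]_n) : R := inf [set a | eigenvalue A a].

Definition sigma_max n (B : 'M[R]_n) : R := Num.sqrt (lambda_max (B^T *m B)).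

Definition sym_part n (B : 'M[R]_n) : 'M[R]_n := 2^-1 *: (B + B^T).

Definition cond_tilde n (B : 'M[R]_n) : R :=
  sigma_max B / lambda_min (sym_part B).

(* P^{-1/2}: the (unique) symmetric positive definite square root of P^{-1}. *)
Definition mx_invsqrt n (P : 'M[R]_n) : 'M[R]_n :=
  xget 0 [set Q | spd Q /\ Q *m Q = invmx P].

End matrix_notions.

Section finite_elements.
Context {R : realType} {d : nat}.
Implicit Types (Omega : set 'rV[R]_d).

Definition vhull nv (vert : 'I_nv -> 'rV[R]_d) (e : {set 'I_nv}) : set 'rV[R]_d :=
  [set x | exists c : 'I_nv -> R,
    [/\ forall i, 0 <= c i, forall i, i \notin e -> c i = 0,
        \sum_i c i = 1 & x = \sum_i c i *: vert i]].

Definition affinely_independent nv (vert : 'I_nv -> 'rV[R]_d) (e : {set 'I_nv}) :=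
  forall c : 'I_nv -> R, (forall i, i \notin e -> c i = 0) ->
    \sum_i c i = 0 -> \sum_i c i *: vert i = 0 -> forall i, c i = 0.

Definition bounded_domain Omega :=
  [/\ open Omega, connected Omega, bounded_set Omega & Omega !=set0].

(* elts lists the vertex sets of the elements. The last two clauses express both
   that Omega is polyhedral and that the mesh fits it: its closure is the union
   of the elements and its boundary is a union of (d-1)-dimensional faces. *)
Definition simplicial_mesh Omega nv (vert : 'I_nv -> 'rV[R]_d)
    (elts : {set {set 'I_nv}}) :=
  [/\ forall e, e \in elts -> #|e| = d.+1 /\ affinely_independent vert e,
      forall e f, e \in elts -> f \in elts ->
        vhull vert e `&` vhull vert f = vhull vert (e :&: f),
      forall i, exists2 e, e \in elts & i \in e,
      closure Omega = \bigcup_(e in [set` elts]) vhull vert e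
    & exists2 faces : {set {set 'I_nv}},
        forall f, f \in faces ->
          #|f| = d /\ exists2 e, e \in elts & f \subset e
      & closure Omega `\` Omega = \bigcup_(f in [set` faces]) vhull vert f].

Definition interior_numbering Omega nv (vert : 'I_nv -> 'rV[R]_d)
    N (iv : 'I_N -> 'I_nv) :=
  injective iv /\ forall i, Omega (vert i) <-> exists k, iv k = i.

Definition affine_on (K : set 'rV[R]_d) (f : 'rV[R]_d -> R) :=
  exists (a : 'cV[R]_d) (b : R), forall x, K x -> f x = (x *m a) 0 0 + b.

Definition nodal_basis Omega nv (vert : 'I_nv -> 'rV[R]_d)
    (elts : {set {set 'I_nv}}) N (iv : 'I_N -> 'I_nv)
    (phi : 'I_N -> 'rV[R]_d -> R) :=
  forall k,
    [/\ {within closure Omega, continuous (phi k)},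
        forall e, e \in elts -> affine_on (vhull vert e) (phi k)
      & forall i, phi k (vert i) = (i == iv k)%:R].

Definition diffusion Omega (D : 'rV[R]_d -> 'M[R]_d) (dmin dmax : R) :=
  [/\ 0 < dmin, 0 < dmax,
      forall i j, measurable_fun Omega (fun x => D x i j)
    & forall x, Omega x -> [/\ (D x)^T = D x,
        loewner_le dmin%:M (D x) & loewner_le (D x) dmax%:M]].

(* For a piecewise linear f this is the gradient in the interior of the elements;
   its unspecified values on the faces, a null set, do not affect integrals. *)
Definition grad (f : 'rV[R]_d -> R) (x : 'rV[R]_d) : 'rV[R]_d :=
  \row_i 'D_(delta_mx ord0 i) f x.

Definition mass_matrix Omega N (phi : 'I_N -> 'rV[R]_d -> R) : 'M[R]_N :=
  \matrix_(k, j) Rintegral (lebesgue_rV d) Omega (fun x => phi k x * phi j x).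

Definition stiffness_matrix Omega (D : 'rV[R]_d -> 'M[R]_d)
    N (phi : 'I_N -> 'rV[R]_d -> R) : 'M[R]_N :=
  \matrix_(k, j) Rintegral (lebesgue_rV d) Omega
    (fun x => (grad (phi k) x *m D x *m (grad (phi j) x)^T) 0 0).

End finite_elements.

Section real_jordan.
Context {R : realType}.

(* A block with m.+1 diagonal entries, resp. m.+1 diagonal 2x2 blocks. *)
Inductive jordan_block :=
  | RealBlock (mu : R) (m : nat)
  | CplxBlock (alpha beta : R) (m : nat).

Definition rot_mx (alpha beta : R) : 'M[R]_2 :=
  \matrix_(i, j) if i == j then alpha else if i == 0 then beta else - beta.

Definition jb_len b : nat :=
  match b with RealBlock _ m | CplxBlock _ _ m => m.+1 end.

Definition jb_dim b : nat :=
  match b with RealBlock _ _ => 1%N | CplxBlock _ _ _ => 2%N end.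

Definition jb_core b : 'M[R]_(jb_dim b) :=
  match b with
  | RealBlock mu _ => mu%:M
  | CplxBlock alpha beta _ => rot_mx alpha beta
  end.

Definition shift_mx m : 'M[R]_m := \matrix_(i, j) (j == i.+1 :> nat)%:R.

(* Block upper bidiagonal, with jb_core b on the block diagonal and the identity
   of size jb_dim b on the block superdiagonal. *)
Definition jb_mx b : 'M[R]_(jb_len b * jb_dim b) :=
  1%:M *t jb_core b + shift_mx (jb_len b) *t 1%:M.

Definition jordan_mx p (B : 'I_p -> jordan_block) s
    (hs : (\sum_(q < p) jb_len (B q) * jb_dim (B q))%N = s) : 'M[R]_s :=
  castmx (hs, hs) (\mxdiag_(q < p) jb_mx (B q)).

Definition real_jordan_form s (Gamma T : 'M[R]_s) p (B : 'I_p -> jordan_block)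
    (hs : (\sum_(q < p) jb_len (B q) * jb_dim (B q))%N = s) :=
  [/\ T \in unitmx,
      forall q alpha beta m, B q = CplxBlock alpha beta m -> beta != 0
    & Gamma = T *m jordan_mx hs *m invmx T].

(* Row of the Jordan matrix at component c of the i-th diagonal block of J_q. *)
Definition jordan_index p (B : 'I_p -> jordan_block) s
    (hs : (\sum_(q < p) jb_len (B q) * jb_dim (B q))%N = s)
    (q : 'I_p) (i : 'I_(jb_len (B q))) (c : 'I_(jb_dim (B q))) : 'I_s :=
  cast_ord hs (tagnat.Rank (p_ := fun q => (jb_len (B q) * jb_dim (B q))%N)
                 q (mxtens_index (i, c))).

End real_jordan.
Arguments jordan_block : clear implicits.

Section stage_system.
Context {R : realType} {N : nat}.
Variables (M A : 'M[R]_N) (dt : R).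

Definition real_coef (mu : R) : 'M[R]_N := M + (mu * dt) *: A.

Definition cplx_coef (alpha beta : R) : 'M[R]_(2 * N) :=
  1%:M *t M + dt *: (rot_mx alpha beta *t A).

Definition stage_system s (Gamma : 'M[R]_s) (u : 'cV[R]_N)
    (v : 'I_s -> 'cV[R]_N) :=
  forall k, M *m v k + dt *: (A *m \sum_j Gamma k j *: v j) = - (A *m u).

Definition stage_mx s (Gamma : 'M[R]_s) : 'M[R]_(s * N) :=
  1%:M *t M + dt *: (Gamma *t A).

Definition transformed_stage_mx s (Gamma T : 'M[R]_s) : 'M[R]_(s * N) :=
  (invmx T *t 1%:M) *m stage_mx Gamma *m (T *t 1%:M).

Definition stack r (v : 'I_r -> 'cV[R]_N) : 'cV[R]_(r * N) :=
  \col_k v (mxtens_unindex k).1 (mxtens_unindex k).2 0.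

Definition next_or_0 m r (w : 'I_m -> 'I_r -> 'cV[R]_N) (i : 'I_m) :
    'I_r -> 'cV[R]_N :=
  if insub i.+1 is Some i' then w i' else fun=> 0.

(* The smaller systems attached to a Jordan block, solved from the last one up:
   the unknown of the i-th system is w i, and w (i + 1) is already known. *)
Definition block_substitution (b : jordan_block R) :
    ('I_(jb_len b) -> 'I_(jb_dim b) -> 'cV[R]_N) ->
    ('I_(jb_len b) -> 'I_(jb_dim b) -> 'cV[R]_N) -> Prop :=
  match b with
  | RealBlock mu m => fun g w => forall i : 'I_m.+1,
      real_coef mu *m w i ord0 = g i ord0 - dt *: (A *m next_or_0 w i ord0)
  | CplxBlock alpha beta m => fun g w => forall i : 'I_m.+1,
      cplx_coef alpha beta *m stack (w i) =
      stack (g i) - dt *: ((1%:M *t A) *m stack (next_or_0 w i))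
  end.

(* w = (T^{-1} (x) I) v are the transformed stages and g the transformed
   right-hand side. *)
Definition jordan_substitution s (T : 'M[R]_s) p (B : 'I_p -> jordan_block R)
    (hs : (\sum_(q < p) jb_len (B q) * jb_dim (B q))%N = s)
    (u : 'cV[R]_N) (v : 'I_s -> 'cV[R]_N) :=
  let w k := \sum_j invmx T k j *: v j in
  let g k := \sum_j invmx T k j *: - (A *m u) in
  forall q : 'I_p, @block_substitution (B q)
    (fun i c => g (jordan_index hs i c)) (fun i c => w (jordan_index hs i c)).

(* The diagonal blocks of the transformed stage matrix in the partition given by
   the diagonal blocks of the Jordan matrix, i.e. the coefficient matrices of the
   linear systems met in block back substitution. *)
Definition pivot_block s (Gamma T : 'M[R]_s) p (B : 'I_p -> jordan_block R)
    (hs : (\sum_(q < p) jb_len (B q) * jb_dim (B q))%N = s)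
    (q : 'I_p) (i : 'I_(jb_len (B q))) : 'M[R]_(jb_dim (B q) * N) :=
  let idx (k : 'I_(jb_dim (B q) * N)) :=
    mxtens_index (jordan_index hs i (mxtens_unindex k).1,
                  (mxtens_unindex k).2) in
  mxsub idx idx (transformed_stage_mx Gamma T).

(* The conditioning of the integration: the largest condition number among the
   linear systems that are solved. *)
Definition rk_conditioning s (Gamma T : 'M[R]_s) p (B : 'I_p -> jordan_block R)
    (hs : (\sum_(q < p) jb_len (B q) * jb_dim (B q))%N = s) : R :=
  \big[Num.max/0]_(q < p) \big[Num.max/0]_(i < jb_len (B q))
    cond_tilde (pivot_block Gamma T hs i).

Definition block_cond (b : jordan_block R) : R :=
  match b with
  | RealBlock mu _ => cond_tilde (real_coef mu)
  | CplxBlock alpha beta _ => cond_tilde (cplx_coef alpha beta)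
  end.

End stage_system.

(* Main.v *)
Require Import Defs.
From HB Require Import structures.
From mathcomp Require Import all_boot all_order all_algebra.
From mathcomp Require Import all_classical all_reals all_analysis.
From mathcomp Require Import complex mxtens measurable_realfun ring lra.

(* The mass matrix is the Gram matrix of the nodal basis in L^2, and a nonzero
   continuous combination of the basis has a positive integral of its square; the
   quadratic form of the stiffness matrix is the integral of w D w^T, where w is a
   combination of the gradients. Hence M is symmetric positive definite and A is
   symmetric positive semidefinite.
   Linearity of the integral requires the gradients to be bounded and measurable
   on the whole domain, faces included: along a ray x + h v a piecewise affine
   function is affine for small h > 0, because some element contains infinitely
   many of the points x + (r / n) v, hence, by convexity, a segment starting at x.
   One-sided derivatives therefore exist everywhere, take finitely many values and
   are limits of measurable difference quotients.

   On the algebraic side, T^-1 (x) I block-triangularises the stage matrix with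
   diagonal blocks I (x) M + dt C (x) A, where C is the 1x1 or 2x2 core of a
   Jordan block. Since C^T C = (alpha^2 + beta^2) I and C + C^T = 2 alpha I, the
   largest singular value of I (x) M + dt C (x) A is at most
   lambda_max M + dt sqrt(alpha^2 + beta^2) lambda_max A by the triangle
   inequality, and its symmetric part is I (x) (M + dt alpha A). *)

Import Order.TTheory GRing.Theory Num.Theory.
Import numFieldNormedType.Exports.

Local Open Scope classical_set_scope.
Local Open Scope complex_scope.
Local Open Scope ring_scope.

Set Implicit Arguments.
Unset Strict Implicit.

(** * Quadratic forms and the real spectral theorem *)

Section quadratic_forms.
Context {R : realType}.
Implicit Types n m : nat.

Definition qform n (S : 'M[R]_n) (x : 'cV[R]_n) : R := (x^T *m S *m x) 0 0.

Definition psd n (S : 'M[R]_n) := S^T = S /\ forall x, 0 <= qform S x.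

Lemma qformD n (S S' : 'M[R]_n) x : qform (S + S') x = qform S x + qform S' x.
Proof. by rewrite /qform mulmxDr mulmxDl mxE. Qed.

Lemma qformZ n c (S : 'M[R]_n) x : qform (c *: S) x = c * qform S x.
Proof. by rewrite /qform -scalemxAr -scalemxAl mxE. Qed.

Lemma qformN n (S : 'M[R]_n) x : qform (- S) x = - qform S x.
Proof. by rewrite -scaleN1r qformZ mulN1r. Qed.

Lemma qform_scalar n c (x : 'cV[R]_n) : qform c%:M x = c * qform 1%:M x.
Proof. by rewrite -[c%:M]scalemx1 qformZ. Qed.

Lemma qform_gram n m (L : 'M[R]_(m, n)) (x : 'cV[R]_n) :
  qform (L^T *m L) x = qform 1%:M (L *m x).
Proof. by rewrite /qform mulmx1 trmx_mul !mulmxA. Qed.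

Lemma qform1E n (x : 'cV[R]_n) : qform 1%:M x = \sum_i x i 0 ^+ 2.
Proof.
rewrite /qform mulmx1 mxE; apply: eq_bigr => i _; by rewrite mxE expr2.
Qed.

Lemma qform1_ge0 n (x : 'cV[R]_n) : 0 <= qform 1%:M x.
Proof. by rewrite qform1E sumr_ge0// => i _; rewrite sqr_ge0. Qed.

Lemma qform1_eq0 n (x : 'cV[R]_n) : (qform 1%:M x == 0) = (x == 0).
Proof.
apply/idP/eqP => [|->]; last by rewrite /qform mulmx0 mxE.
rewrite qform1E psumr_eq0 => [/allP x0|i _]; last by rewrite sqr_ge0.
apply/colP => i; rewrite mxE; apply/eqP.
by rewrite -sqrf_eq0; exact/x0/mem_index_enum.
Qed.

Lemma qform1_gt0 n (x : 'cV[R]_n) : x != 0 -> 0 < qform 1%:M x.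
Proof. by move=> x0; rewrite lt_neqAle qform1_ge0 andbT eq_sym qform1_eq0. Qed.

(** The triangle inequality for the Euclidean norm, kept in squared form to avoid square roots; it
    rests on Cauchy-Schwarz. *)
Lemma qform1_add n (x y : 'cV[R]_n) (a b : R) : 0 <= a -> 0 <= b ->
  qform 1%:M x <= a ^+ 2 -> qform 1%:M y <= b ^+ 2 ->
  qform 1%:M (x + y) <= (a + b) ^+ 2.
Proof.
move=> a0 b0 xa yb.
have [a00|an0] := eqVneq a 0.
  have /eqP -> : x == 0.
    by rewrite -qform1_eq0 eq_le qform1_ge0 andbT (le_trans xa)// a00 expr0n.
  by rewrite add0r a00 add0r.
have [b00|bn0] := eqVneq b 0.
  have /eqP -> : y == 0.
    by rewrite -qform1_eq0 eq_le qform1_ge0 andbT (le_trans yb)// b00 expr0n.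
  by rewrite addr0 b00 addr0.
have ab0 : 0 < a * b by rewrite mulr_gt0// lt_neqAle eq_sym ?an0 ?bn0.
pose c := \sum_i x i 0 * y i 0.
have eD (s t : R) : qform 1%:M (s *: x + t *: y) =
    s ^+ 2 * qform 1%:M x + 2 * (s * t) * c + t ^+ 2 * qform 1%:M y.
  rewrite !qform1E /c !big_distrr/= -!big_split/=.
  by apply: eq_bigr => i _; rewrite !mxE; ring.
(* Expanding |b x - a y|^2 >= 0 gives 2 a b c <= b^2 |x|^2 + a^2 |y|^2 <= 2 (a b)^2, hence c <= a b.
   The zero cases were split off so that a b > 0 can be cancelled. *)
have := qform1_ge0 (b *: x + (- a) *: y).
rewrite eD => h; have := eD 1 1; rewrite !scale1r => ->.
have h1 : b ^+ 2 * qform 1%:M x <= b ^+ 2 * a ^+ 2 by rewrite ler_wpM2l ?sqr_ge0.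
have h2 : a ^+ 2 * qform 1%:M y <= a ^+ 2 * b ^+ 2 by rewrite ler_wpM2l ?sqr_ge0.
have : (a * b) * c <= (a * b) * (a * b) by nra.
by rewrite ler_pM2l//; nra.
Qed.

End quadratic_forms.

(** * The spectral theorem for real symmetric matrices *)

Section spectral_theorem.
Context {R : realType}.
Implicit Types n : nat.

(** A complex eigenvalue p + iq exists, with eigenvector a + ib. Symmetry equates b^T S a with a^T S
    b, which gives q (|a|^2 + |b|^2) = 0, so the eigenvalue is real. *)
Lemma sym_eigenvalue_exists n (S : 'M[R]_n) : (0 < n)%N -> S^T = S ->
  exists a, eigenvalue S a.
Proof.
move=> n0 Ssym; pose f := real_complex R.
have [z zS] := @eigenvalue_closed R[i] n (map_mx f S) n0.
have /eigenvalueP[v vS v0] := zS.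
pose a : 'cV[R]_n := \col_j complex.Re (v 0 j).
pose b : 'cV[R]_n := \col_j complex.Im (v 0 j).
have vE j : v 0 j = a j 0 +i* b j 0 by rewrite !mxE; case: (v 0 j).
have zE : z = complex.Re z +i* complex.Im z by case: (z).
have vSE k : \sum_j v 0 j * (S j k)%:C = z * v 0 k.
  have := congr1 (fun w : 'rV[R[i]]_n => w 0 k) vS; rewrite !mxE => <-.
  by apply: eq_bigr => j _; rewrite !mxE.
have aSE : S *m a = complex.Re z *: a - complex.Im z *: b.
  apply/colP => k; have := congr1 (@complex.Re R) (vSE k).
  rewrite raddf_sum vE {1}zE /= -/(complex.Re z) !mxE => <-.
  by apply: eq_bigr => j _; rewrite -{1}Ssym !mxE; case: (v 0 j) => x y /=;
    rewrite mulr0 subr0 mulrC.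
have bSE : S *m b = complex.Re z *: b + complex.Im z *: a.
  apply/colP => k; have := congr1 (@complex.Im R) (vSE k).
  rewrite raddf_sum vE {1}zE /= !mxE => <-.
  by apply: eq_bigr => j _; rewrite -{1}Ssym !mxE; case: (v 0 j) => x y /=;
    rewrite mulr0 add0r mulrC.
have ab0 : qform 1%:M a + qform 1%:M b != 0.
  rewrite paddr_eq0 ?qform1_ge0// !qform1_eq0; apply: contraNN v0 => /andP[a0 b0].
  by apply/eqP/rowP => j; rewrite vE (eqP a0) (eqP b0) !mxE.
have tr11 (X : 'M[R]_1) : X 0 0 = X^T 0 0 by rewrite mxE.
have q0 : complex.Im z = 0.
  apply/(mulIf ab0); rewrite mul0r.
  have : (b^T *m (S *m a)) 0 0 = (a^T *m (S *m b)) 0 0.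
    by rewrite [RHS]tr11 !trmx_mul trmxK Ssym mulmxA.
  have abC : (a^T *m b) 0 0 = (b^T *m a) 0 0.
    by rewrite [LHS]tr11 trmx_mul trmxK.
  have lin (X Y : 'M[R]_1) (p q : R) : (p *: X + q *: Y) 0 0 = p * X 0 0 + q * Y 0 0.
    by rewrite !mxE.
  rewrite aSE bSE -scaleNr !mulmxDr -!scalemxAr !lin abC /qform !mulmx1; lra.
exists (complex.Re z); move: zS; rewrite !eigenvalue_root_char -map_char_poly/=.
by rewrite {1}zE q0 -/((complex.Re z)%:C) fmorph_root.
Qed.

(** The reflection in the hyperplane orthogonal to w = v - e exchanges the unit vectors e and v; for
    w = 0 the identity serves. *)
Lemma householder n (v : 'rV[R]_n.+1) : v *m v^T = 1%:M ->
  exists H : 'M[R]_n.+1, [/\ H^T = H, H *m H = 1%:M & delta_mx 0 0 *m H = v].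
Proof.
move=> v1; pose e : 'rV[R]_n.+1 := delta_mx 0 0; pose w := v - e.
have [w0|w0] := eqVneq w 0.
  exists 1%:M; rewrite trmx1 mulmx1; split => //; rewrite mulmx1.
  by apply/esym/eqP; rewrite -subr_eq0; apply/eqP.
pose c := (w *m w^T) 0 0.
have cE : w *m w^T = c%:M by rewrite [LHS]mx11_scalar.
have c0 : c != 0.
  have := qform1_eq0 (w^T); rewrite /qform mulmx1 trmxK -/c => ->.
  by rewrite trmx_eq0.
exists (1%:M - (2 / c) *: (w^T *m w)); split.
- by rewrite linearB linearZ/= trmx1 trmx_mul trmxK.
- set E := w^T *m w; have EE : E *m E = c *: E.
    by rewrite /E -mulmxA [w *m (_ *m _)]mulmxA cE mul_scalar_mx scalemxAr.
  rewrite mulmxBr mulmx1 mulmxBl mul1mx -scalemxAl -scalemxAr EE !scalerA.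
  rewrite -addrA -[RHS]addr0; congr (_ + _).
  have -> : 2 / c * (2 / c) * c = 2 / c + 2 / c by field.
  by rewrite scalerDl opprB addrK addNr.
- rewrite -/e mulmxBr mulmx1 -scalemxAr mulmxA.
  have ee : e *m e^T = 1%:M.
    rewrite /e trmx_delta mul_delta_mx.
    by apply/matrixP => i j; rewrite !ord1 !mxE eqxx.
  pose g := (e *m v^T) 0 0.
  have gE : e *m v^T = g%:M by rewrite [LHS]mx11_scalar.
  have gE' : v *m e^T = g%:M by rewrite -[v]trmxK -trmx_mul gE tr_scalar_mx.
  have sB (a b : R) : a%:M - b%:M = (a - b)%:M :> 'M[R]_1 by rewrite raddfB.
  have -> : e *m w^T = (g - 1)%:M.
    by rewrite /w linearB/= mulmxBr gE ee sB.
  (* As v and e are unit vectors, |w|^2 = 2 - 2 g. This makes the coefficient of w equal to 1 in the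
     image of e, which is therefore e + w = v. *)
  have : c%:M = (2 - 2 * g)%:M :> 'M[R]_1.
    rewrite -cE /w linearB/= mulmxBr !mulmxBl v1 ee gE gE' !sB.
    by congr (_ %:M); ring.
  move=> /(congr1 (fun X : 'M[R]_1 => X 0 0)); rewrite !mxE eqxx !mulr1n => cg.
  rewrite mul_scalar_mx scalerA.
  have -> : 2 / c * (g - 1) = - 1.
    by apply: (mulIf c0); rewrite mulrAC mulfVK// mulN1r cg; ring.
  by rewrite scaleN1r opprK addrC subrK.
Qed.

(** Deflation by induction on the size: for a reflection [H] taking e to a unit eigenvector, the
    first row of H S H is a e, so by symmetry H S H splits into the entry a and a smaller symmetric
    block. *)
Lemma sym_spectral n (S : 'M[R]_n) : S^T = S ->
  exists (U : 'M[R]_n) (l : 'rV[R]_n),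
    U *m U^T = 1%:M /\ S = U^T *m diag_mx l *m U.
Proof.
elim: n S => [|n IH] S Ssym.
  by exists 1%:M, 0; split; [rewrite trmx1 mulmx1|rewrite [LHS]flatmx0 [RHS]flatmx0].
have [a /eigenvalueP[v0 v0S v00]] := sym_eigenvalue_exists (ltn0Sn n) Ssym.
pose c := qform 1%:M v0^T.
have c0 : 0 < c by apply: qform1_gt0; rewrite trmx_eq0.
pose v := (Num.sqrt c)^-1 *: v0.
have vS : v *m S = a *: v by rewrite -scalemxAl v0S scalerA mulrC -scalerA.
have v1 : v *m v^T = 1%:M.
  rewrite /v linearZ/= -scalemxAr -scalemxAl scalerA [v0 *m _]mx11_scalar.
  have -> : (v0 *m v0^T) 0 0 = c by rewrite /c /qform mulmx1 trmxK.
  rewrite -scalemx1 scalerA -invfM -expr2 sqr_sqrtr ?ltW// mulVf ?gt_eqF//.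
  by rewrite scale1r.
have [H [Hs HH eH]] := householder v1.
pose S' : 'M[R]_(1 + n) := H *m S *m H.
have SE : S = H *m S' *m H.
  by rewrite /S' !mulmxA HH mul1mx -mulmxA HH mulmx1.
have S's : S'^T = S' by rewrite /S' !trmx_mul Hs Ssym mulmxA.
have r0 : usubmx S' = row_mx a%:M 0.
  have -> : usubmx S' = delta_mx 0 0 *m S'.
    apply/matrixP => i j; rewrite !ord1 -rowE [LHS]mxE [RHS]mxE; congr (S' _ _).
    exact/val_inj.
  rewrite /S' !mulmxA eH vS -scalemxAl -eH -mulmxA HH mulmx1.
  apply/matrixP => i j; rewrite !ord1 !mxE.
  case: splitP => k jk.
    rewrite ord1 !mxE !eqxx/= (_ : j == 0) ?mulr1//.
    by apply/eqP/val_inj; rewrite /= jk ord1.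
  rewrite !mxE (_ : j == 0 = false) ?mulr0//.
  by apply/negbTE/eqP => /(congr1 val)/=; rewrite jk.
have ur0 : ursubmx S' = 0 by rewrite /ursubmx r0 row_mxKr.
have ul0 : ulsubmx S' = a%:M by rewrite /ulsubmx r0 row_mxKl.
have dl0 : dlsubmx S' = 0 by rewrite -S's -trmx_ursub ur0 trmx0.
have [V [l [VV SV]]] : exists (U : 'M[R]_n) (l : 'rV[R]_n),
    U *m U^T = 1%:M /\ drsubmx S' = U^T *m diag_mx l *m U.
  by apply: IH; rewrite trmx_drsub S's.
have S'E : S' = block_mx a%:M 0 0 (V^T *m diag_mx l *m V).
  by rewrite -[LHS]submxK ur0 ul0 dl0 SV.
clearbody S'; pose W : 'M[R]_(1 + n) := block_mx 1%:M 0 0 V.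
have WW : W *m W^T = 1%:M.
  rewrite tr_block_mx mulmx_block !trmx0 trmx1 !mulmx0 !mul0mx !addr0 !add0r.
  by rewrite mulmx1 VV -scalar_mx_block.
exists (W *m H), (row_mx a%:M l); split.
  by rewrite trmx_mul Hs -mulmxA (mulmxA H) HH mul1mx.
rewrite SE.
rewrite trmx_mul Hs !mulmxA; congr (_ *m _); rewrite -!mulmxA; congr (_ *m _).
have DE : diag_mx (row_mx a%:M l) = block_mx a%:M 0 0 (diag_mx l).
  rewrite diag_mx_row; congr block_mx.
  by apply/matrixP => i j; rewrite !ord1 !mxE.
transitivity (W^T *m (block_mx a%:M 0 0 (diag_mx l) *m W)); last by rewrite -DE.
rewrite S'E /W tr_block_mx !mulmx_block.
by rewrite !trmx0 trmx1 !mulmx0 !mul0mx !addr0 !add0r !mulmx1 !mul1mx !mulmx0 mulmxA.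
Qed.

End spectral_theorem.

(** * Extremal eigenvalues and bounds on quadratic forms *)

Section extremal_eigenvalues.
Context {R : realType}.
Implicit Types n : nat.

Section spectral_decomposition.
Context n (S U : 'M[R]_n) (l : 'rV[R]_n).
Hypotheses (UU : U *m U^T = 1%:M) (SE : S = U^T *m diag_mx l *m U).

Let UU' : U^T *m U = 1%:M. Proof. exact: mulmx1C. Qed.

(** In the coordinates v U^T the matrix is diagonal, so a nonzero coordinate i forces a = l_i;
    conversely row i of [U] is an eigenvector for l_i. *)
Lemma spectral_eigenvalueP a : eigenvalue S a <-> exists i, l 0 i = a.
Proof.
split=> [/eigenvalueP[v vS v0]|[i <-]].
  have y0 : v *m U^T != 0.
    apply: contraNN v0 => /eqP vU.
    by rewrite -[v]mulmx1 -UU' mulmxA vU mul0mx.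
  have /rV0Pn[i yi] := y0; exists i; apply: (mulfI yi).
  have : v *m U^T *m diag_mx l = a *: (v *m U^T).
    by rewrite scalemxAl -vS SE !mulmxA -[_ *m U *m U^T]mulmxA UU mulmx1.
  move: (v *m U^T) => y /rowP/(_ i); rewrite mul_mx_diag !mxE => ->.
  exact: mulrC.
apply/eigenvalueP; exists (row i U).
  rewrite SE !mulmxA -row_mul UU -row_mul mul1mx -row_mul; apply/rowP => j.
  by rewrite !mxE (bigD1 i)//= big1 ?addr0 ?mxE ?eqxx ?mulr1n// => k ki;
    rewrite !mxE eq_sym (negbTE ki) mulr0n mul0r.
apply/eqP => /(congr1 (fun w => w *m U^T)); rewrite -row_mul UU mul0mx.
by move=> /rowP/(_ i); rewrite !mxE eqxx => /eqP; rewrite oner_eq0.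
Qed.

Lemma spectral_qform x : qform S x = \sum_i l 0 i * (U *m x) i 0 ^+ 2.
Proof.
rewrite /qform SE !mulmxA -trmx_mul -mulmxA mul_mx_diag mxE.
by apply: eq_bigr => i _; rewrite !mxE; ring.
Qed.

Lemma spectral_qform1 x : qform 1%:M x = \sum_i (U *m x) i 0 ^+ 2.
Proof. by rewrite -UU' qform_gram qform1E. Qed.

(** [F] is f(S) in the functional calculus; it supplies the square of [S], its square root and its
    inverse square root. *)
Lemma spectral_fun (f : R -> R) :
  let F := U^T *m diag_mx (map_mx f l) *m U in
  [/\ F^T = F, forall x, qform F x = \sum_i f (l 0 i) * (U *m x) i 0 ^+ 2
    & F *m F = U^T *m diag_mx (map_mx (fun t => f t ^+ 2) l) *m U].
Proof.
split.
- by rewrite !trmx_mul trmxK tr_diag_mx mulmxA.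
- move=> x; rewrite /qform !mulmxA -trmx_mul -mulmxA mul_mx_diag mxE.
  by apply: eq_bigr => i _; rewrite !mxE; ring.
- rewrite !mulmxA; congr (_ *m _); rewrite -!mulmxA; congr (_ *m _).
  rewrite (mulmxA U) UU mul1mx mulmx_diag; congr diag_mx.
  by apply/rowP => i; rewrite !mxE expr2.
Qed.

End spectral_decomposition.

Lemma eigenvalue_qform n (S : 'M[R]_n) a : S^T = S -> eigenvalue S a ->
  exists2 x : 'cV[R]_n, x != 0 & qform S x = a * qform 1%:M x.
Proof.
move=> Ssym /eigenvalueP[v vS v0]; exists v^T; rewrite ?trmx_eq0//.
by rewrite /qform trmxK vS mulmx1 -scalemxAl mxE.
Qed.

(** [sup] is meaningful only on a nonempty bounded set; the eigenvalues are the l_i, bounded by the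
    sum of their absolute values. *)
Lemma eigenvalues_has_sup n (S : 'M[R]_n) : (0 < n)%N -> S^T = S ->
  has_sup [set a | eigenvalue S a].
Proof.
move=> n0 Ssym; split; first exact: sym_eigenvalue_exists.
have [U [l [UU SE]]] := sym_spectral Ssym.
exists (\sum_i `|l 0 i|) => a /(spectral_eigenvalueP UU SE)[i <-].
by rewrite (bigD1 i)//= (le_trans (ler_norm _))// lerDl sumr_ge0.
Qed.

Lemma eigenvalues_has_inf n (S : 'M[R]_n) : (0 < n)%N -> S^T = S ->
  has_inf [set a | eigenvalue S a].
Proof.
move=> n0 Ssym; split; first exact: sym_eigenvalue_exists.
have [U [l [UU SE]]] := sym_spectral Ssym.
exists (- \sum_i `|l 0 i|) => a /(spectral_eigenvalueP UU SE)[i <-].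
rewrite (bigD1 i)//= lerNl (le_trans (ler_norm _))// normrN.
by rewrite lerDl sumr_ge0.
Qed.

Lemma eigenvalue_le_max n (S : 'M[R]_n) a : (0 < n)%N -> S^T = S ->
  eigenvalue S a -> a <= lambda_max S.
Proof. by move=> n0 Ssym aS; apply: sup_upper_bound => //; exact: eigenvalues_has_sup. Qed.

Lemma eigenvalue_ge_min n (S : 'M[R]_n) a : (0 < n)%N -> S^T = S ->
  eigenvalue S a -> lambda_min S <= a.
Proof. by move=> n0 Ssym aS; apply: ge_inf => //; have [] := eigenvalues_has_inf n0 Ssym. Qed.

Lemma lambda_min_lb n (S : 'M[R]_n) c : (0 < n)%N -> S^T = S ->
  (forall x, c * qform 1%:M x <= qform S x) -> c <= lambda_min S.
Proof.
move=> n0 Ssym cS; apply: lb_le_inf; first exact: sym_eigenvalue_exists.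
move=> a /(eigenvalue_qform Ssym)[x x0 xa]; have := cS x.
by rewrite xa ler_pM2r// qform1_gt0.
Qed.

Lemma lambda_max_ub n (S : 'M[R]_n) c : (0 < n)%N -> S^T = S ->
  (forall x, qform S x <= c * qform 1%:M x) -> lambda_max S <= c.
Proof.
move=> n0 Ssym cS; apply: ge_sup; first exact: sym_eigenvalue_exists.
move=> a /(eigenvalue_qform Ssym)[x x0 xa]; have := cS x.
by rewrite xa ler_pM2r// qform1_gt0.
Qed.

Lemma qform_ge_lambda_min n (S : 'M[R]_n) x : (0 < n)%N -> S^T = S ->
  lambda_min S * qform 1%:M x <= qform S x.
Proof.
move=> n0 Ssym; have [U [l [UU SE]]] := sym_spectral Ssym.
rewrite (spectral_qform SE) (spectral_qform1 UU) big_distrr/=.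
apply: ler_sum => i _; rewrite ler_wpM2r ?sqr_ge0//.
by apply: eigenvalue_ge_min => //; apply/(spectral_eigenvalueP UU SE); exists i.
Qed.

Lemma psd_lambda_max_ge0 n (S : 'M[R]_n) : (0 < n)%N -> psd S ->
  0 <= lambda_max S.
Proof.
move=> n0 [Ssym S0]; have [a aS] := sym_eigenvalue_exists n0 Ssym.
apply: le_trans (eigenvalue_le_max n0 Ssym aS).
have [x x0 xa] := eigenvalue_qform Ssym aS.
by move: (S0 x); rewrite xa pmulr_lge0// qform1_gt0.
Qed.

Lemma psd_lambda_min_ge0 n (S : 'M[R]_n) : (0 < n)%N -> psd S ->
  0 <= lambda_min S.
Proof.
by move=> n0 [Ssym S0]; apply: lambda_min_lb => // x; rewrite mul0r.
Qed.

(** In an eigenbasis the form of S^2 has coefficients l_i^2, and 0 <= l_i <= [lambda_max S] allows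
    the upper bound to be squared. *)
Lemma psd_sqr_qform n (S : 'M[R]_n) x : (0 < n)%N -> psd S ->
  qform (S *m S) x <= lambda_max S ^+ 2 * qform 1%:M x.
Proof.
move=> n0 [Ssym S0]; have [U [l [UU SE]]] := sym_spectral Ssym.
have lE i : eigenvalue S (l 0 i) by apply/(spectral_eigenvalueP UU SE); exists i.
have lid : map_mx (fun t : R => t) l = l by apply/rowP => i; rewrite mxE.
have [_ _] := spectral_fun l UU (fun t => t); rewrite lid -SE => SS.
rewrite (spectral_qform SS) (spectral_qform1 UU) big_distrr/=.
apply: ler_sum => i _; rewrite ler_wpM2r ?sqr_ge0// mxE.
rewrite ler_sqr ?nnegrE ?(psd_lambda_max_ge0 n0)//; first exact: eigenvalue_le_max.
by rewrite (le_trans _ (eigenvalue_ge_min n0 Ssym (lE i)))// psd_lambda_min_ge0.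
Qed.

(** [L] is the symmetric square root of [S]. Size 0 is treated apart because the eigenvalue bounds
    ask for a positive size. *)
Lemma psd_gram n (S : 'M[R]_n) : psd S -> exists L : 'M[R]_n, S = L^T *m L.
Proof.
case: n S => [|n] S [Ssym S0].
  by exists 0; rewrite [LHS]flatmx0 [RHS]flatmx0.
have [U [l [UU SE]]] := sym_spectral Ssym.
have l0 i : 0 <= l 0 i.
  apply: le_trans (psd_lambda_min_ge0 (ltn0Sn n) (conj Ssym S0)) _.
  by apply: eigenvalue_ge_min => //; apply/(spectral_eigenvalueP UU SE); exists i.
have [F1 _ F2] := spectral_fun l UU Num.sqrt.
exists (U^T *m diag_mx (map_mx Num.sqrt l) *m U); rewrite F1 F2 SE.
congr (_ *m diag_mx _ *m _); apply/rowP => i.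
by rewrite !mxE sqr_sqrtr.
Qed.

Lemma spd_psd n (S : 'M[R]_n) : spd S -> psd S.
Proof.
move=> [Ssym S0]; split => // x.
have [->|x0] := eqVneq x 0; first by rewrite /qform mulmx0 mxE.
exact/ltW/S0.
Qed.

Lemma spd_lambda_min_gt0 n (S : 'M[R]_n) : (0 < n)%N -> spd S ->
  0 < lambda_min S.
Proof.
move=> n0 [Ssym S0]; have [U [l [UU SE]]] := sym_spectral Ssym.
case: n n0 S U l Ssym S0 UU SE => // n n0 S U l Ssym S0 UU SE.
have lE i : eigenvalue S (l 0 i) by apply/(spectral_eigenvalueP UU SE); exists i.
have l0 i : 0 < l 0 i.
  have [x x0 xa] := eigenvalue_qform Ssym (lE i).
  by move: (S0 _ x0); rewrite -/(qform S x) xa pmulr_lgt0// qform1_gt0.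
(* The smallest of the finitely many l_i is a positive lower bound; positivity of each eigenvalue
   alone would only give a nonnegative infimum. *)
pose i0 := [arg min_(i < ord0) l 0 i]%O.
apply: lt_le_trans (l0 i0) _; apply: lb_le_inf; first exact: sym_eigenvalue_exists.
move=> a /(spectral_eigenvalueP UU SE)[i <-]; rewrite /i0.
by case: arg_minP => // j _; apply.
Qed.

Lemma spd_invsqrt_exists n (P : 'M[R]_n) : spd P ->
  exists Q, spd Q /\ Q *m Q = invmx P.
Proof.
case: n P => [|n] P Pspd.
  exists 0; split; last by rewrite [LHS]flatmx0 [RHS]flatmx0.
  split; first by rewrite [LHS]flatmx0.
  by move=> x; rewrite (flatmx0 x) eqxx.
have [Psym P0] := Pspd; have [U [l [UU SE]]] := sym_spectral Psym.
have l0 i : 0 < l 0 i.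
  apply: lt_le_trans (spd_lambda_min_gt0 (ltn0Sn n) Pspd) _.
  by apply: eigenvalue_ge_min => //; apply/(spectral_eigenvalueP UU SE); exists i.
have [F1 F2 F3] := spectral_fun l UU (fun t => (Num.sqrt t)^-1).
exists (U^T *m diag_mx (map_mx (fun t => (Num.sqrt t)^-1) l) *m U); split.
  split => // x x0; rewrite -/(qform _ x) F2.
  have : U *m x != 0.
    apply: contraNN x0 => /eqP Ux.
    by rewrite -[x]mul1mx -(mulmx1C UU) -mulmxA Ux mulmx0.
  move=> /matrix0Pn[i [j]]; rewrite ord1 => Uxi.
  rewrite (bigD1 i)//= ltr_pwDl//.
    by rewrite mulr_gt0 ?invr_gt0 ?sqrtr_gt0// exprn_even_gt0.
  by apply: sumr_ge0 => k _; rewrite mulr_ge0 ?invr_ge0 ?sqrtr_ge0 ?sqr_ge0.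
rewrite F3 {F1 F2 F3}; set Z := (X in X = _).
have ZP : Z *m P = 1%:M.
  rewrite /Z SE !mulmxA -[_ *m U *m U^T]mulmxA UU mulmx1 -[_ *m _ *m diag_mx l]mulmxA.
  rewrite mulmx_diag (_ : diag_mx _ = 1%:M) ?mulmx1 ?(mulmx1C UU)//.
  rewrite -[RHS]diag_const_mx; congr diag_mx; apply/rowP => i; rewrite !mxE.
  by rewrite exprVn sqr_sqrtr ?ltW// mulVf// gt_eqF.
have [Pu _] := mulmx1_unit (mulmx1C ZP).
by rewrite -[RHS]mul1mx -ZP mulmxK.
Qed.

(** Once a square root of the inverse exists, [xget] returns a matrix with the defining property
    instead of its default 0. *)
Lemma mx_invsqrt_spd n (P : 'M[R]_n) : spd P -> spd (mx_invsqrt P).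
Proof.
by move=> /spd_invsqrt_exists exQ; rewrite /mx_invsqrt; have [] := xgetPex 0 exQ.
Qed.

Lemma qform_congr n (Q S : 'M[R]_n) x : Q^T = Q ->
  qform (Q *m S *m Q) x = qform S (Q *m x).
Proof. by move=> Qs; rewrite /qform trmx_mul Qs !mulmxA. Qed.

Lemma psd_congr n (Q S : 'M[R]_n) : Q^T = Q -> psd S -> psd (Q *m S *m Q).
Proof.
move=> Qs [Ss S0]; split; first by rewrite !trmx_mul Qs Ss mulmxA.
by move=> x; rewrite qform_congr.
Qed.

Lemma spd_congr n (Q S : 'M[R]_n) : spd Q -> spd S -> spd (Q *m S *m Q).
Proof.
move=> [Qs Q0] [Ss S0]; split; first by rewrite !trmx_mul Qs Ss mulmxA.
move=> x x0; rewrite -/(qform _ x) qform_congr//; apply: S0.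
by apply: contraTN (Q0 _ x0) => /eqP Qx; rewrite -mulmxA Qx mulmx0 mxE ltxx.
Qed.

End extremal_eigenvalues.

(** * Conditioning of the complex blocks *)

Section kronecker.
Context {R : comNzRingType}.

Lemma tensmxDr m n p q (X : 'M[R]_(m, n)) (Y Z : 'M[R]_(p, q)) :
  X *t (Y + Z) = X *t Y + X *t Z.
Proof. by apply/matrixP => i j; rewrite !mxE mulrDr. Qed.

Lemma tensmxDl m n p q (X Y : 'M[R]_(m, n)) (Z : 'M[R]_(p, q)) :
  (X + Y) *t Z = X *t Z + Y *t Z.
Proof. by apply/matrixP => i j; rewrite !mxE mulrDl. Qed.

Lemma tensmxZr m n p q c (X : 'M[R]_(m, n)) (Y : 'M[R]_(p, q)) :
  X *t (c *: Y) = c *: (X *t Y).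
Proof. by apply/matrixP => i j; rewrite !mxE mulrCA. Qed.

Lemma tensmxZl m n p q c (X : 'M[R]_(m, n)) (Y : 'M[R]_(p, q)) :
  (c *: X) *t Y = c *: (X *t Y).
Proof. by apply/matrixP => i j; rewrite !mxE mulrA. Qed.

Lemma tensmx11 m n : (1%:M : 'M[R]_m) *t (1%:M : 'M[R]_n) = 1%:M.
Proof.
apply/matrixP => i j; case: (mxtens_indexP i) => i1 i2.
case: (mxtens_indexP j) => j1 j2.
rewrite tensmxE !mxE (can_eq (@mxtens_indexK _ _)) xpair_eqE.
by case: eqP; case: eqP => //= _ _; rewrite ?mulr0 ?mul0r ?mulr1.
Qed.

End kronecker.

Section cplx_conditioning.
Context {R : realType}.

(** The difference S' - S is a Gram matrix L^T L, and I (x) L^T L is the Gram matrix of I (x) L.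
    Bounds on N-dimensional forms thus carry over without computing the spectrum of a Kronecker
    product. *)
Lemma qform_tens1_le k n (S S' : 'M[R]_n) : S^T = S -> S'^T = S' ->
  (forall x, qform S x <= qform S' x) ->
  forall x, qform ((1%:M : 'M[R]_k) *t S) x <= qform (1%:M *t S') x.
Proof.
move=> Ss S's le x.
have p : psd (S' - S).
  by split=> [|y]; rewrite ?linearB/= ?Ss ?S's// qformD qformN subr_ge0.
have [L LE] := psd_gram p.
have -> : S' = S + L^T *m L by rewrite -LE addrC subrK.
rewrite tensmxDr qformD lerDl.
have -> : (1%:M : 'M[R]_k) *t (L^T *m L) = (1%:M *t L)^T *m (1%:M *t L).
  by rewrite trmx_tens tensmx_mul trmx1 mulmx1.
by rewrite qform_gram qform1_ge0.
Qed.

Lemma sym_part_sym n (B : 'M[R]_n) : (sym_part B)^T = sym_part B.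
Proof. by rewrite /sym_part linearZ linearD/= trmxK addrC. Qed.

Lemma rot_mx_sym_part alpha beta :
  rot_mx alpha beta + (rot_mx alpha beta)^T = (2 * alpha)%:M :> 'M[R]_2.
Proof.
apply/matrixP => i j; rewrite !mxE.
by case: i j => -[|[|//]] ? [[|[|//]] ?] /=; rewrite ?mulr1n ?mulr0n; ring.
Qed.

Lemma rot_mx_gram alpha beta :
  (rot_mx alpha beta)^T *m rot_mx alpha beta = (alpha ^+ 2 + beta ^+ 2)%:M :> 'M[R]_2.
Proof.
apply/matrixP => i j; rewrite !mxE !big_ord_recl big_ord0 !mxE.
by case: i j => -[|[|//]] ? [[|[|//]] ?] /=; rewrite ?mulr1n ?mulr0n; ring.
Qed.

Lemma cplx_coef_sym_part N (M A : 'M[R]_N) dt alpha beta : M^T = M -> A^T = A ->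
  sym_part (cplx_coef M A dt alpha beta) = 1%:M *t (M + (dt * alpha) *: A).
Proof.
move=> Ms As; rewrite /sym_part /cplx_coef [(_ + _)^T]linearD/=.
rewrite [(_ *: _)^T]linearZ/= !trmx_tens trmx1 Ms As.
rewrite addrACA -scalerDr -(tensmxDl (rot_mx _ _)) rot_mx_sym_part.
rewrite -[(2 * alpha)%:M]scalemx1 tensmxZl.
have -> : 1%:M *t M + 1%:M *t M = 2 *: ((1%:M : 'M[R]_2) *t M).
  by rewrite scaler_nat mulr2n.
rewrite tensmxDr tensmxZr scalerDr !scalerA.
congr (_ + _); first by rewrite mulVf ?scale1r// pnatr_eq0.
by congr (_ *: _); field.
Qed.

(** By the mixed product rule, preconditioning preserves the form of the matrix and only replaces
    [M] and [A] by Q M Q and Q A Q; estimates for arbitrary spd [M] and psd [A] therefore cover the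
    preconditioned case. *)
Lemma cplx_coef_congr N (M A Q : 'M[R]_N) dt alpha beta :
  (1%:M *t Q) *m cplx_coef M A dt alpha beta *m (1%:M *t Q) =
  cplx_coef (Q *m M *m Q) (Q *m A *m Q) dt alpha beta.
Proof.
rewrite /cplx_coef mulmxDr mulmxDl -scalemxAr -scalemxAl !tensmx_mul.
by rewrite !mulmx1 !mul1mx.
Qed.

Context (N : nat) (M A : 'M[R]_N) (dt alpha beta : R).
Hypotheses (N0 : (0 < N)%N) (Mspd : spd M) (Apsd : psd A).
Hypotheses (dt0 : 0 <= dt) (alpha0 : 0 <= alpha).

Let Ms : M^T = M. Proof. by case: Mspd. Qed.
Let As : A^T = A. Proof. by case: Apsd. Qed.
Let N20 : (0 < 2 * N)%N. Proof. by rewrite muln_gt0. Qed.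
Let K := cplx_coef M A dt alpha beta.
Let lo := lambda_min M + dt * alpha * lambda_min A.
Let hi := lambda_max M + dt * Num.sqrt (alpha ^+ 2 + beta ^+ 2) * lambda_max A.

Let lo_gt0 : 0 < lo.
Proof.
rewrite ltr_pwDl ?spd_lambda_min_gt0// mulr_ge0 ?mulr_ge0//.
exact: psd_lambda_min_ge0.
Qed.

Let hi_ge0 : 0 <= hi.
Proof.
rewrite addr_ge0 ?psd_lambda_max_ge0//; first exact: spd_psd.
by rewrite !mulr_ge0 ?sqrtr_ge0// psd_lambda_max_ge0.
Qed.

Let sym_part_lb x : lo * qform 1%:M x <= qform (sym_part K) x.
Proof.
rewrite cplx_coef_sym_part//.
have -> : lo * qform 1%:M x = qform ((1%:M : 'M[R]_2) *t lo%:M) x.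
  by rewrite -[lo%:M]scalemx1 tensmxZr tensmx11 qformZ.
apply: qform_tens1_le; rewrite ?tr_scalar_mx ?linearD ?linearZ/= ?Ms ?As// => y.
rewrite qform_scalar qformD qformZ mulrDl lerD ?qform_ge_lambda_min//.
by rewrite -!mulrA ler_wpM2l// ler_wpM2l// qform_ge_lambda_min.
Qed.

Lemma cplx_coef_posdef : posdef (sym_part K).
Proof.
move=> x x0; apply: lt_le_trans (sym_part_lb x).
by rewrite mulr_gt0// qform1_gt0.
Qed.

(** The mixed product rule gives (C (x) S)^T (C (x) S) = r^2 I (x) S^2. Both terms are instances: C
    = I, r = 1 for [M], and C = dt [rot_mx], r = dt sqrt(alpha^2 + beta^2) for [A]. *)
Let sqr_tens_ub (S : 'M[R]_N) (C : 'M[R]_2) (r : R) x : psd S -> 0 <= r ->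
  C^T *m C = (r ^+ 2)%:M ->
  qform 1%:M ((C *t S) *m x) <= (r * lambda_max S) ^+ 2 * qform 1%:M x.
Proof.
move=> Spsd r0 CC; have [Ss _] := Spsd.
rewrite -qform_gram trmx_tens tensmx_mul CC Ss -[(r ^+ 2)%:M]scalemx1 tensmxZl qformZ.
rewrite exprMn -[leRHS]mulrA ler_wpM2l ?sqr_ge0//.
rewrite (_ : lambda_max S ^+ 2 * _ = qform ((1%:M : 'M[R]_2) *t (lambda_max S ^+ 2)%:M) x); last first.
  by rewrite -[(lambda_max S ^+ 2)%:M]scalemx1 tensmxZr tensmx11 qformZ.
apply: qform_tens1_le; rewrite ?tr_scalar_mx ?trmx_mul ?Ss// => y.
by rewrite qform_scalar; exact: psd_sqr_qform.
Qed.

Lemma cplx_coef_sigma_max_le : sigma_max K <= hi.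
Proof.
rewrite /sigma_max -(ger0_norm hi_ge0) -sqrtr_sqr ler_wsqrtr//.
apply: lambda_max_ub => //; first by rewrite trmx_mul trmxK.
move=> x; rewrite qform_gram /K /cplx_coef mulmxDl -scalemxAl.
set c := Num.sqrt (qform 1%:M x).
have c0 : 0 <= c by exact: sqrtr_ge0.
have c2 : qform 1%:M x = c ^+ 2 by rewrite sqr_sqrtr// qform1_ge0.
have Mpsd := spd_psd Mspd.
set rho := Num.sqrt (alpha ^+ 2 + beta ^+ 2).
have rho0 : 0 <= rho by exact: sqrtr_ge0.
(* Distributing c = |x| over the two terms of [hi] gives the shape of the triangle inequality. *)
have -> : hi ^+ 2 * qform 1%:M x =
    (lambda_max M * c + dt * rho * lambda_max A * c) ^+ 2.
  by rewrite c2 -mulrDl exprMn.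
apply: qform1_add.
- by rewrite mulr_ge0// psd_lambda_max_ge0.
- by rewrite !mulr_ge0// psd_lambda_max_ge0.
- rewrite [leRHS]exprMn -c2 -[lambda_max M]mul1r; apply: sqr_tens_ub => //.
  by rewrite trmx1 mulmx1 expr1n.
- rewrite scalemxAl -tensmxZl [leRHS]exprMn -c2.
  apply: sqr_tens_ub => //; first exact: mulr_ge0.
  have -> : (dt *: rot_mx alpha beta)^T = dt *: (rot_mx alpha beta)^T.
    by rewrite linearZ.
  rewrite -scalemxAl -scalemxAr scalerA rot_mx_gram exprMn sqr_sqrtr.
    by rewrite scale_scalar_mx expr2.
  by rewrite addr_ge0 ?sqr_ge0.
Qed.

Lemma cplx_coef_cond_le : cond_tilde K <= hi / lo.
Proof.
have le : lo <= lambda_min (sym_part K).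
  by apply: lambda_min_lb => //; exact: sym_part_sym.
have gt0 := lt_le_trans lo_gt0 le.
apply: (@le_trans _ _ (hi / lambda_min (sym_part K))).
  by rewrite ler_wpM2r ?invr_ge0 ?(ltW gt0)// cplx_coef_sigma_max_le.
by rewrite ler_wpM2l// lef_pV2.
Qed.

End cplx_conditioning.

(** * Eigenvalues of a real Jordan form *)

Section jordan_eigenvalues.

Lemma sum_mxtens_index (V : nmodType) m n (F : 'I_(m * n) -> V) :
  \sum_k F k = \sum_i \sum_j F (mxtens_index (i, j)).
Proof.
rewrite pair_big/= (reindex (@mxtens_index m n))/=.
  by apply: eq_bigr => -[].
by exists (@mxtens_unindex m n) => k _; rewrite ?mxtens_indexK ?mxtens_unindexK.
Qed.

Lemma eigenvalue_conj (F : fieldType) n (P J : 'M[F]_n) z : P \in unitmx ->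
  eigenvalue (P *m J *m invmx P) z <-> eigenvalue J z.
Proof.
move=> Pu; split=> /eigenvalueP[v vE v0]; apply/eigenvalueP.
  exists (v *m P).
    by rewrite scalemxAl -vE !mulmxA mulmxKV.
  by apply: contraNN v0 => /eqP vP; rewrite -(mulmxK Pu v) vP mul0mx.
exists (v *m invmx P).
  by rewrite !mulmxA mulmxKV// vE scalemxAl.
by apply: contraNN v0 => /eqP vP; rewrite -(mulmxKV Pu v) vP mul0mx.
Qed.

Lemma eigenvalue_mxdiag (F : fieldType) p (p_ : 'I_p -> nat)
    (D : forall q, 'M[F]_(p_ q)) z :
  eigenvalue (\mxdiag_q D q) z <-> exists q, eigenvalue (D q) z.
Proof.
split=> [/eigenvalueP[v vE v0]|[q /eigenvalueP[w wE w0]]].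
  have [q vq] : exists q, submxrow v q != 0.
    apply: contrapT => /forallNP vq; move/negP: v0; apply; apply/eqP.
    by rewrite -(submxrowK v); apply/mxrowP => q; rewrite mxrowK submxrow0;
      apply/eqP; case: eqP (vq q).
  exists q; apply/eigenvalueP; exists (submxrow v q) => //.
  have := congr1 (fun X => submxrow X q) vE.
  rewrite -{1}(submxrowK v) mul_mxrow_mxdiag mxrowK => ->.
  by apply/matrixP => i j; rewrite !mxE.
(* The eigenvector of block q is extended by zero; as block sizes depend on the index, [w] is
   transported along q = q'. *)
pose f q' : 'rV[F]_(p_ q') :=
  if @eqP _ q q' is ReflectT e then ecast q' ('rV[F]_(p_ q')) e w else 0.
have fq : f q = w by rewrite /f; case: eqP => // e; rewrite (eq_axiomK e).
apply/eigenvalueP; exists (\mxrow_q' f q').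
  rewrite mul_mxrow_mxdiag; apply/mxrowP => q'; rewrite mxrowK.
  have -> : submxrow (z *: \mxrow_q' f q') q' = z *: f q'.
    by rewrite -[in RHS](mxrowK f q'); apply/matrixP => i j; rewrite !mxE.
  rewrite /f; case: eqP => [e|_]; last by rewrite mul0mx scaler0.
  by case: _ / e.
apply: contraNN w0 => /eqP f0; rewrite -fq -(mxrowK f q) f0 submxrow0.
exact: eqxx.
Qed.

(** Eigenvectors are row vectors here, and block j of v X is v_j K + v_(j-1). An eigenvector of [K]
    put in the last block is one of X; conversely, if z is not an eigenvalue of [K], then v_0 = 0
    and, inductively, every v_j = 0. *)
Lemma eigenvalue_bidiag (F : fieldType) m k (K : 'M[F]_k) z :
  eigenvalue ((1%:M : 'M[F]_m.+1) *t K
    + (\matrix_(i, j) (j == i.+1 :> nat)%:R) *t 1%:M) z <-> eigenvalue K z.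
Proof.
set X := (X in eigenvalue X).
have XE (v : 'rV[F]_(m.+1 * k)) j c : (v *m X) 0 (mxtens_index (j, c)) =
    (\sum_c' v 0 (mxtens_index (j, c')) * K c' c) +
    \sum_(i < m.+1) (j == i.+1 :> nat)%:R * v 0 (mxtens_index (i, c)).
  rewrite mxE sum_mxtens_index /X.
  under eq_bigr => i _ do under eq_bigr => c' _ do
    rewrite mxE !tensmxE ![_%:M _ _]mxE [X in X * _%:R]mxE mulrDr.
  under eq_bigr => i _ do rewrite big_split/=.
  rewrite big_split/=; congr (_ + _).
    rewrite (bigD1 j)//= [X in _ + X]big1 ?addr0 => [|i ij].
            by apply: eq_bigr => c' _; rewrite eqxx mul1r.
    by rewrite big1// => c' _; rewrite (negbTE ij) mul0r mulr0.
  apply: eq_bigr => i _; rewrite (bigD1 c)//= [X in _ + X]big1 ?addr0 => [|c' cc].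
    by rewrite eqxx mulr1 mulrC.
  by rewrite (negbTE cc) !mulr0.
split=> [/eigenvalueP[v vE v0]|/eigenvalueP[w wE w0]]; last first.
  pose v : 'rV[F]_(m.+1 * k) := \row_l
    (((mxtens_unindex l).1 == ord_max)%:R * w 0 (mxtens_unindex l).2).
  have vI j c : v 0 (mxtens_index (j, c)) = (j == ord_max)%:R * w 0 c.
    by rewrite mxE mxtens_indexK.
  apply/eigenvalueP; exists v.
    apply/rowP => l; case: (mxtens_indexP l) => j c; rewrite XE mxE vI.
    rewrite [X in _ + X]big1 ?addr0 => [|i _].
      have /rowP/(_ c) := wE; rewrite !mxE => wEc.
      rewrite mulrCA -wEc big_distrr/=.
      by apply: eq_bigr => c' _; rewrite vI mulrA.
    rewrite vI; case: eqP => [ji|_]; last by rewrite mul0r.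
    case: eqP => [im|_]; last by rewrite mul0r mulr0.
    by have := ltn_ord j; rewrite ji im /= ltnn.
  apply: contraNN w0 => /eqP v0; apply/eqP/rowP => c.
  by have := vI ord_max c; rewrite v0 eqxx mul1r !mxE.
apply: contrapT => nK.
have K0 (w : 'rV[F]_k) : w *m K = z *: w -> w = 0.
  move=> wE; apply/eqP; apply: contrapT => /negP w0; apply: nK.
  by apply/eigenvalueP; exists w.
have step (i : 'I_m.+1) :
    (forall (i' : 'I_m.+1) c, (i'.+1 = i)%N -> v 0 (mxtens_index (i', c)) = 0) ->
    forall c, v 0 (mxtens_index (i, c)) = 0.
  move=> v0' c.
  suff /rowP/(_ c) : \row_c' v 0 (mxtens_index (i, c')) = 0 by rewrite !mxE.
  apply: K0; apply/rowP => c'; have /rowP/(_ (mxtens_index (i, c'))) := vE.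
  rewrite XE [X in _ + X]big1 ?addr0 => [|i' _].
    by rewrite !mxE => <-; apply: eq_bigr => c'' _; rewrite mxE.
  by case: eqP => [ii|_]; rewrite ?mul0r// v0' ?mulr0.
have vi0 n (i : 'I_m.+1) : (i <= n)%N -> forall c, v 0 (mxtens_index (i, c)) = 0.
  elim: n i => [|n IH] i ile; apply: step => i' c ii; last first.
    by apply: IH; rewrite -ltnS ii.
  by move: ile; rewrite -ii.
move/negP: v0; apply; apply/eqP/rowP => l; case: (mxtens_indexP l) => i c.
by rewrite (vi0 i i)// mxE.
Qed.

Lemma eigenvalue_scalar1 (F : fieldType) (a z : F) :
  eigenvalue (a%:M : 'M[F]_1) z <-> z = a.
Proof.
split=> [/eigenvalueP[v]|->].
  rewrite mul_mx_scalar => /eqP; rewrite -subr_eq0 -scalerBl scaler_eq0.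
  by rewrite subr_eq0 => /orP[/eqP ->//|->].
apply/eigenvalueP; exists 1%:M; first by rewrite mul_mx_scalar.
by apply/eqP => /matrixP/(_ 0 0); rewrite !mxE => /eqP; rewrite oner_eq0.
Qed.

Lemma eigenvalue_rot (R : rcfType) (alpha beta : R) (z : R[i]) :
  eigenvalue (\matrix_(i < 2, j < 2)
    if i == j then alpha%:C else if i == 0 then beta%:C else - beta%:C) z <->
  z = alpha +i* beta \/ z = alpha +i* (- beta).
Proof.
set K := (X in eigenvalue X).
(* Reduces an equation to a known one and an identity that [ring] can check. *)
have lin (a b c d : R[i]) : c = d -> a - b = c - d -> a = b.
  by move=> -> ; rewrite subrr => /eqP; rewrite subr_eq0 => /eqP.
have KE (v : 'rV[R[i]]_2) : v *m K = z *: v <->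
    v 0 0 * (alpha%:C - z) = v 0 1 * beta%:C /\
    v 0 0 * beta%:C = v 0 1 * (z - alpha%:C).
  split=> [/rowP vE|[e0 e1]].
    have := vE 0; have := vE 1; rewrite !mxE !big_ord_recl !big_ord0 !mxE/=.
    have -> : lift ord0 ord0 = 1 :> 'I_2 by exact/val_inj.
    by move=> e1 e0; split; [apply: (lin _ _ _ _ e0)|apply: (lin _ _ _ _ e1)]; ring.
  apply/rowP => j; rewrite !mxE !big_ord_recl !big_ord0 !mxE/=.
  have -> : lift ord0 ord0 = 1 :> 'I_2 by exact/val_inj.
  case: j => -[|[|//]] jlt.
    rewrite (_ : Ordinal jlt = 0); last exact/val_inj.
    by apply: (lin _ _ _ _ e0) => /=; ring.
  rewrite (_ : Ordinal jlt = 1); last exact/val_inj.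
    by apply: (lin _ _ _ _ e1) => /=; ring.
have factor : (z - alpha%:C) ^+ 2 + beta%:C ^+ 2 =
    (z - (alpha +i* beta)) * (z - (alpha +i* (- beta))).
  have -> : alpha +i* beta = alpha%:C + 'i%C * beta%:C by rewrite [LHS]complexE.
  have -> : alpha +i* (- beta) = alpha%:C - 'i%C * beta%:C.
    by rewrite [LHS]complexE /= rmorphN mulrN.
  apply: (lin _ _ (beta%:C ^+ 2 * 'i%C ^+ 2) (beta%:C ^+ 2 * -1)); last by ring.
  by rewrite sqr_i.
split=> [/eigenvalueP[v /KE[e0 e1] v0]|].
  (* Eliminating one coordinate from the two equations shows that each coordinate is annihilated by
     the characteristic polynomial at z; one coordinate is nonzero. *)
  have : v 0 0 * ((z - alpha%:C) ^+ 2 + beta%:C ^+ 2) = 0.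
    apply: (lin _ _ (v 0 0 * (alpha%:C - z) * (alpha%:C - z) +
      v 0 0 * beta%:C * beta%:C) 0); last by ring.
    by rewrite e0 e1; ring.
  have : v 0 1 * ((z - alpha%:C) ^+ 2 + beta%:C ^+ 2) = 0.
    apply: (lin _ _ (v 0 1 * (z - alpha%:C) * (z - alpha%:C) +
      v 0 1 * beta%:C * beta%:C) 0); last by ring.
    by rewrite -e0 -e1; ring.
  rewrite factor => /eqP + /eqP; rewrite !mulf_eq0 !subr_eq0.
  case/or3P => [v1|/eqP|/eqP]; [|by left|by right].
  case/or3P => [v00|/eqP|/eqP]; [|by left|by right].
  exfalso; move/negP: v0; apply; apply/eqP/rowP => j; rewrite mxE.
  case: j => -[|[|//]] jlt.
    by rewrite (_ : Ordinal jlt = 0); [exact/eqP|exact/val_inj].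
  by rewrite (_ : Ordinal jlt = 1); [exact/eqP|exact/val_inj].
(* The eigenvectors are (1, y), with y = -i for alpha + i beta and y = i for its conjugate. *)
have ev (y : R[i]) : alpha%:C - z = y * beta%:C ->
    beta%:C = y * (z - alpha%:C) -> eigenvalue K z.
  move=> e0 e1; apply/eigenvalueP; exists (\row_j if j == 0 then 1 else y).
    by apply/KE; rewrite !mxE/= !mul1r.
  by apply/eqP => /rowP/(_ 0); rewrite !mxE => /eqP; rewrite oner_eq0.
case=> zE.
- by apply: (ev (- 'i%C)); apply/eqP; rewrite zE eq_complex /=; apply/andP; split;
    apply/eqP; ring.
- by apply: (ev 'i%C); apply/eqP; rewrite zE eq_complex /=; apply/andP; split;
    apply/eqP; ring.
Qed.

Context {R : realType}.

Definition jb_eigenvalue (b : jordan_block R) (z : R[i]) : Prop :=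
  match b with
  | RealBlock mu _ => z = mu%:C
  | CplxBlock alpha beta _ => z = alpha +i* beta \/ z = alpha +i* (- beta)
  end.

Lemma jb_mx_eigenvalue (b : jordan_block R) (z : R[i]) :
  eigenvalue (map_mx (real_complex R) (jb_mx b)) z <-> jb_eigenvalue b z.
Proof.
have -> : map_mx (real_complex R) (jb_mx b) =
    1%:M *t map_mx (real_complex R) (jb_core b)
    + (\matrix_(i, j) (j == i.+1 :> nat)%:R) *t 1%:M.
  rewrite /jb_mx map_mxD !map_mxT !map_mx1; congr (_ + _ *t _).
  by apply/matrixP => i j; rewrite !mxE rmorph_nat.
case: b => [mu m|alpha beta m]; rewrite eigenvalue_bidiag /=.
  by rewrite map_scalar_mx eigenvalue_scalar1.
rewrite -eigenvalue_rot; set K := map_mx _ _; set K' := (X in _ <-> is_true (eigenvalue X z)).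
suff -> : K = K' by [].
apply/matrixP => i j; rewrite !mxE; case: eqP => // _.
by case: eqP => // _; rewrite rmorphN.
Qed.

Lemma jordan_form_eigenvalue s (Gamma T : 'M[R]_s) p (B : 'I_p -> jordan_block R)
    (hs : (\sum_(q < p) jb_len (B q) * jb_dim (B q))%N = s) (z : R[i]) :
  real_jordan_form Gamma T hs ->
  eigenvalue (map_mx (real_complex R) Gamma) z <-> exists q, jb_eigenvalue (B q) z.
Proof.
subst s => -[Tu _ ->]; rewrite /jordan_mx castmx_id !map_mxM map_invmx.
rewrite eigenvalue_conj ?map_unitmx//.
have -> : map_mx (real_complex R) (\mxdiag_q jb_mx (B q)) =
    \mxdiag_q map_mx (real_complex R) (jb_mx (B q)).
  apply/mxblockP => i j; rewrite /mxdiag mxblockK.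
  transitivity (map_mx (real_complex R) (submxblock (\mxdiag_q jb_mx (B q)) i j)).
    by apply/matrixP => k l; rewrite !mxE.
  rewrite /mxdiag mxblockK; case: eqVneq => [->|_]; last by rewrite map_mx0.
  by rewrite !conform_mx_id.
rewrite eigenvalue_mxdiag.
by split=> -[q] /jb_mx_eigenvalue; exists q.
Qed.

End jordan_eigenvalues.

(** * The transformed stage system *)

Section stage_systems.
Context {R : realType} {N : nat}.
Implicit Types (M A : 'M[R]_N) (dt : R).

(** With the stages as rows, X (x) Y acts as V |-> X V Y^T, so the change of variables by [T] is a
    plain left multiplication. *)
Definition rows_mx s (v : 'I_s -> 'cV[R]_N) : 'M[R]_(s, N) :=
  \matrix_(k, a) v k a 0.

Lemma mul_rows_mx s (X : 'M[R]_s) v :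
  rows_mx (fun k => \sum_j X k j *: v j) = X *m rows_mx v.
Proof.
apply/matrixP => k a; rewrite !mxE summxE.
by apply: eq_bigr => j _; rewrite !mxE.
Qed.

Lemma stage_rowsP M A dt s (X : 'M[R]_s) (v g : 'I_s -> 'cV[R]_N) :
  (forall k, M *m v k + dt *: (A *m \sum_j X k j *: v j) = g k) <->
  rows_mx v *m M^T + dt *: (X *m rows_mx v *m A^T) = rows_mx g.
Proof.
have E k a : (rows_mx v *m M^T + dt *: (X *m rows_mx v *m A^T)) k a =
    (M *m v k + dt *: (A *m \sum_j X k j *: v j)) a 0.
  rewrite -mul_rows_mx !mxE; congr (_ + _ * _).
    by apply: eq_bigr => b _; rewrite !mxE mulrC.
  by apply: eq_bigr => b _; rewrite !mxE mulrC.
split=> h; first by apply/matrixP => k a; rewrite E h mxE.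
by move=> k; apply/colP => a; rewrite -E h mxE.
Qed.

(** Left multiplication of the stage equations by the invertible T^-1 is an equivalence and turns V
    into T^-1 V. *)
Lemma stage_system_conj M A dt s (J T : 'M[R]_s) u v : T \in unitmx ->
  stage_system M A dt (T *m J *m invmx T) u v <->
  forall k, M *m (\sum_j invmx T k j *: v j)
    + dt *: (A *m \sum_j J k j *: \sum_l invmx T j l *: v l) =
    \sum_j invmx T k j *: - (A *m u).
Proof.
move=> Tu; rewrite /stage_system (stage_rowsP M A dt _ v (fun=> - (A *m u))).
rewrite (stage_rowsP M A dt J (fun k => \sum_j invmx T k j *: v j)
  (fun k => \sum_j invmx T k j *: - (A *m u))).
rewrite !mul_rows_mx; set V := rows_mx v; set G := rows_mx _.
have -> : invmx T *m V *m M^T + dt *: (J *m (invmx T *m V) *m A^T) =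
    invmx T *m (V *m M^T + dt *: (T *m J *m invmx T *m V *m A^T)).
  by rewrite mulmxDr -scalemxAr !mulmxA mulVmx// mul1mx.
split=> [-> //|e].
by rewrite -[LHS](mulKVmx Tu) e mulKVmx.
Qed.

Lemma mxdiag_row_sum p (p_ : 'I_p -> nat) (D : forall q, 'M[R]_(p_ q)) x q k :
  \sum_j (\mxdiag_q D q) (tagnat.Rank q k) j * x j =
  \sum_k' D q k k' * x (tagnat.Rank q k').
Proof.
pose X : 'cV[R]__ := \col_j x j.
have := mul_mxdiag_mxcol D (submxcol X); rewrite submxcolK.
move=> /(congr1 (fun Y => submxcol Y q)); rewrite mxcolK.
move=> /(congr1 (fun Y : 'cV[R]_(p_ q) => Y k 0)); rewrite !mxE.
move=> e; transitivity (\sum_j (\mxdiag_q D q) (tagnat.Rank q k) j * X j 0).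
  by apply: eq_bigr => j _; congr (_ * _); rewrite mxE.
by rewrite e; apply: eq_bigr => j _; congr (_ * _); rewrite !mxE.
Qed.

Lemma next_or_0E m r (w : 'I_m -> 'I_r -> 'cV[R]_N) i c :
  next_or_0 w i c = \sum_(i' < m) (i' == i.+1 :> nat)%:R *: w i' c.
Proof.
rewrite /next_or_0; case: insubP => [i' _ ii|nlt].
  rewrite (bigD1 i')//= ii eqxx scale1r big1 ?addr0// => k ki.
  by rewrite -ii val_eqE (negbTE ki) scale0r.
rewrite big1// => i' _; case: eqP => [ii|]; last by rewrite scale0r.
by move: nlt; rewrite -ii ltn_ord.
Qed.

(** * Rows of the Jordan matrix *)

Section jordan_rows.
Context (s p : nat) (B : 'I_p -> jordan_block R).
Context (hs : (\sum_(q < p) jb_len (B q) * jb_dim (B q))%N = s).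

Lemma jordan_index_surj k : exists q i c, k = @jordan_index R p B s hs q i c.
Proof.
subst s; rewrite -(tagnat.sig2K k).
case: (mxtens_indexP (tagnat.sig2 k)) => i c; exists (tagnat.sig1 k), i, c.
by rewrite /jordan_index cast_ord_id.
Qed.

Lemma jordan_index_eq q (i : 'I_(jb_len (B q))) c c' :
  (jordan_index hs i c == jordan_index hs i c') = (c == c').
Proof.
apply/eqP/eqP => [|->//]; rewrite /jordan_index => /cast_ord_inj /eqP.
rewrite -val_eqE/= tagnat.eq_Rank eqxx/= => /eqP.
by move=> /addnI/ord_inj.
Qed.

Lemma jb_mxE b (i i' : 'I_(jb_len b)) (c c' : 'I_(jb_dim b)) :
  @jb_mx R b (mxtens_index (i, c)) (mxtens_index (i', c')) =
  (i == i')%:R * jb_core b c c' + (i' == i.+1 :> nat)%:R * (c == c')%:R.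
Proof. by rewrite /jb_mx mxE !tensmxE !mxE. Qed.

Lemma jordan_mx_diag_block q (i : 'I_(jb_len (B q))) c c' :
  jordan_mx hs (jordan_index hs i c) (jordan_index hs i c') = jb_core (B q) c c'.
Proof.
subst s; rewrite /jordan_mx castmx_id /jordan_index !cast_ord_id.
have /matrixP/(_ (mxtens_index (i, c)) (mxtens_index (i, c'))) :=
  submxblock_diag (fun q => jb_mx (B q)) q.
rewrite mxE => ->; rewrite jb_mxE eqxx mul1r.
by rewrite (_ : (_ == _ :> nat) = false) ?mul0r ?addr0// ltn_eqF.
Qed.

(** A Jordan row meets its own diagonal block through the core and, through the identity on the
    superdiagonal, the same component of the next block; after the last block that term is 0. *)
Lemma jordan_row_sum (w : 'I_s -> 'cV[R]_N) q (i : 'I_(jb_len (B q))) c :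
  \sum_j jordan_mx hs (jordan_index hs i c) j *: w j =
  \sum_c' jb_core (B q) c c' *: w (jordan_index hs i c')
  + next_or_0 (fun i c => w (jordan_index hs i c)) i c.
Proof.
rewrite next_or_0E; apply/colP => a; rewrite mxE !summxE.
under eq_bigr do rewrite mxE.
under [X in _ = X + _]eq_bigr do rewrite mxE.
under [X in _ = _ + X]eq_bigr do rewrite mxE.
subst s; rewrite /jordan_mx castmx_id /jordan_index.
under [X in _ = X + _]eq_bigr do rewrite cast_ord_id.
under [X in _ = _ + X]eq_bigr do rewrite cast_ord_id.
rewrite cast_ord_id (mxdiag_row_sum (fun q => jb_mx (B q)) (fun j => w j a 0)).
rewrite [LHS](sum_mxtens_index _).
under [LHS]eq_bigr => i' _.
  under eq_bigr => c' _ do rewrite jb_mxE mulrDl.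
  rewrite big_split/=; over.
rewrite big_split/=; congr (_ + _).
  rewrite (bigD1 i)//= [X in _ + X]big1 ?addr0 => [|i' ii].
    by apply: eq_bigr => c' _; rewrite eqxx mul1r.
  by rewrite big1// => c' _; rewrite eq_sym (negbTE ii) !mul0r.
apply: eq_bigr => i' _; rewrite (bigD1 c)//= [X in _ + X]big1 ?addr0 => [|c' cc].
  by rewrite eqxx mulr1.
by rewrite [c == _]eq_sym (negbTE cc) mulr0 mul0r.
Qed.

End jordan_rows.

Lemma tens_mul_stack r (X : 'M[R]_r) (Y : 'M[R]_N) (w : 'I_r -> 'cV[R]_N) :
  (X *t Y) *m stack w = stack (fun c => Y *m \sum_c' X c c' *: w c').
Proof.
apply/colP => k; case: (mxtens_indexP k) => c a.
rewrite !mxE mxtens_indexK /= sum_mxtens_index exchange_big/=.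
apply: eq_bigr => b _; rewrite summxE big_distrr/=.
by apply: eq_bigr => c' _; rewrite tensmxE !mxE mxtens_indexK /=; ring.
Qed.

Lemma stack_inj r (w w' : 'I_r -> 'cV[R]_N) :
  stack w = stack w' <-> forall c, w c = w' c.
Proof.
split=> [e c|e]; last by congr stack; apply/funext.
apply/colP => a; have /colP/(_ (mxtens_index (c, a))) := e.
by rewrite !mxE mxtens_indexK.
Qed.

Lemma stack_lin r (w w' : 'I_r -> 'cV[R]_N) c :
  stack w + c *: stack w' = stack (fun k => w k + c *: w' k).
Proof. by apply/colP => k; rewrite !mxE. Qed.

Lemma sum_scalar1_mx r (w : 'I_r -> 'cV[R]_N) c :
  \sum_c' (1%:M : 'M[R]_r) c c' *: w c' = w c.
Proof.
rewrite (bigD1 c)//= [X in _ + X]big1 ?addr0 => [|c' cc].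
  by rewrite mxE eqxx scale1r.
by rewrite mxE eq_sym (negbTE cc) scale0r.
Qed.

(** Moving the known next unknown back to the left, and unstacking the complex case, gives both
    kinds of block one form, matching the rows of the Jordan matrix. *)
Lemma block_substitutionE M A dt (b : jordan_block R) g w :
  block_substitution M A dt (b := b) g w <->
  forall i c, M *m w i c
    + dt *: (A *m (\sum_c' jb_core b c c' *: w i c' + next_or_0 w i c)) = g i c.
Proof.
have move_next (X Z G : 'cV[R]_N) : X = G - dt *: Z <-> X + dt *: Z = G.
  by split=> [->|<-]; rewrite ?subrK ?addrK.
have split_next (b' : jordan_block R) w' i c : M *m w' i c
    + dt *: (A *m (\sum_c' jb_core b' c c' *: w' i c' + next_or_0 w' i c)) =
    M *m w' i c + dt *: (A *m (\sum_c' jb_core b' c c' *: w' i c'))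
    + dt *: (A *m next_or_0 w' i c).
  by rewrite mulmxDr scalerDr addrA.
case: b g w => [mu m|alpha beta m] g w.
  have E i : real_coef M A dt mu *m w i ord0 = M *m w i ord0 +
      dt *: (A *m \sum_c' jb_core (RealBlock mu m) ord0 c' *: w i c').
    rewrite big_ord1 mxE eqxx mulr1n /real_coef mulmxDl -scalemxAl -scalemxAr.
    by rewrite scalerA [mu * dt]mulrC.
  split=> h i => [c|].
    by rewrite split_next !ord1; apply/move_next; rewrite -E; exact: h.
  by rewrite E; apply/move_next; rewrite -split_next; exact: h.
have E i : cplx_coef M A dt alpha beta *m stack (w i) = stack (fun c =>
    M *m w i c + dt *: (A *m
      \sum_c' jb_core (CplxBlock alpha beta m) c c' *: w i c')).
  rewrite /cplx_coef mulmxDl -scalemxAl !tens_mul_stack stack_lin.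
  by apply/stack_inj => c; rewrite sum_scalar1_mx.
have E' i : stack (g i) - dt *: ((1%:M *t A) *m stack (next_or_0 w i)) =
    stack (fun c => g i c - dt *: (A *m next_or_0 w i c)).
  rewrite tens_mul_stack -scaleNr stack_lin.
  by apply/stack_inj => c; rewrite sum_scalar1_mx scaleNr.
split=> h i => [c|].
  rewrite split_next; apply/move_next; move: (h i).
  by rewrite E E' => /stack_inj/(_ c).
by rewrite E E'; apply/stack_inj => c; apply/move_next; rewrite -split_next.
Qed.

Lemma jordan_substitutionP M A dt s (Gamma T : 'M[R]_s) p
    (B : 'I_p -> jordan_block R)
    (hs : (\sum_(q < p) jb_len (B q) * jb_dim (B q))%N = s) u v :
  real_jordan_form Gamma T hs ->
  stage_system M A dt Gamma u v <-> jordan_substitution M A dt T hs u v.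
Proof.
move=> [Tu _ ->]; rewrite stage_system_conj// /jordan_substitution.
split=> h.
  move=> q; apply/block_substitutionE => i c.
  by rewrite -(jordan_row_sum hs (fun k => \sum_j invmx T k j *: v j)) h.
move=> k; have [q [i [c ->]]] := jordan_index_surj hs k.
by rewrite jordan_row_sum; have /block_substitutionE := h q; apply.
Qed.

Lemma transformed_stage_mxE M A dt s (J T : 'M[R]_s) : T \in unitmx ->
  transformed_stage_mx M A dt (T *m J *m invmx T) T = stage_mx M A dt J.
Proof.
move=> Tu; rewrite /transformed_stage_mx /stage_mx mulmxDr mulmxDl.
rewrite -scalemxAr -scalemxAl !tensmx_mul !mulmx1 !mul1mx mulVmx//.
by rewrite !mulmxA mulVmx// mul1mx mulmxKV.
Qed.

Lemma pivot_blockE M A dt s (Gamma T : 'M[R]_s) p (B : 'I_p -> jordan_block R)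
    (hs : (\sum_(q < p) jb_len (B q) * jb_dim (B q))%N = s) q i :
  real_jordan_form Gamma T hs ->
  @pivot_block R N M A dt s Gamma T p B hs q i =
  1%:M *t M + dt *: (jb_core (B q) *t A).
Proof.
move=> [Tu _ ->]; rewrite /pivot_block transformed_stage_mxE//.
apply/matrixP => k l; case: (mxtens_indexP k) => c a.
case: (mxtens_indexP l) => c' a'.
rewrite mxE !mxtens_indexK /= /stage_mx !mxE !mxtens_indexK /= jordan_mx_diag_block.
by rewrite jordan_index_eq.
Qed.

(** A real block has a pivot of size [1 * N], equal to [N] only propositionally, so condition
    numbers must be transported along a cast. *)
Lemma cond_tilde_cast n n' (e : n = n') (X : 'M[R]_n) :
  cond_tilde (castmx (e, e) X) = cond_tilde X.
Proof. by case: _ / e; rewrite castmx_id. Qed.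

Lemma castmx_lin n n' (e e' : n = n') (X Y : 'M[R]_n) c :
  castmx (e, e') X + c *: castmx (e, e') Y = castmx (e, e) (X + c *: Y).
Proof.
by rewrite (eq_irrelevance e' e); case: _ / e {e'}; rewrite !castmx_id.
Qed.

Lemma cond_pivot_block M A dt s (Gamma T : 'M[R]_s) p (B : 'I_p -> jordan_block R)
    (hs : (\sum_(q < p) jb_len (B q) * jb_dim (B q))%N = s) q i :
  real_jordan_form Gamma T hs ->
  cond_tilde (@pivot_block R N M A dt s Gamma T p B hs q i) =
  block_cond M A dt (B q).
Proof.
move=> hJ; rewrite pivot_blockE//; case: (B q) => //= mu _.
rewrite !tens_scalar_mx castmx_lin cond_tilde_cast scale1r scalerA.
by rewrite /real_coef mulrC.
Qed.

Lemma rk_conditioningE M A dt s (Gamma T : 'M[R]_s) p (B : 'I_p -> jordan_block R)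
    (hs : (\sum_(q < p) jb_len (B q) * jb_dim (B q))%N = s) :
  real_jordan_form Gamma T hs ->
  rk_conditioning M A dt Gamma T hs =
  \big[Num.max/0]_(q < p) block_cond M A dt (B q).
Proof.
move=> hJ; rewrite /rk_conditioning.
under eq_bigr => q _ do under eq_bigr => i _ do rewrite cond_pivot_block//.
apply/eqP; rewrite eq_le; apply/andP; split.
  apply: bigmax_le => [|q _]; first exact: bigmax_ge_id.
  apply: bigmax_le => [|i _]; first exact: bigmax_ge_id.
  exact: (le_bigmax _ (fun q => block_cond M A dt (B q))).
apply: bigmax_le => [|q _]; first exact: bigmax_ge_id.
(* Every Jordan block has at least one diagonal block, so its condition number does occur in the
   inner maximum. *)
have i0 : 'I_(jb_len (B q)) by case: (B q) => [mu m|alpha beta m]; exact: ord0.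
apply: le_trans (le_bigmax _ (fun=> block_cond M A dt (B q)) i0) _.
exact: (le_bigmax _ (fun q => \big[Num.max/0]_(i < jb_len (B q)) block_cond M A dt (B q))).
Qed.

End stage_systems.

(** * Lebesgue measure on row vectors *)

Section open_sets_rV.
Context {R : realType} {d : nat}.
Implicit Types (x : 'rV[R]_d) (U : set 'rV[R]_d).

(** For e > 0 this is the open ball of the max norm, written as a product of intervals so that its
    measure is explicit. *)
Definition box x (e : R) : set 'rV[R]_d :=
  [set y | forall i, `|x ord0 i - y ord0 i| < e].

Lemma open_rV_box U x : open U -> U x -> exists2 e : R, 0 < e & box x e `<=` U.
Proof.
rewrite openE => oU Ux; have /nbhs_ballP[e/= e0 eU] := oU _ Ux.
exists e => // y xy; apply: eU; split => // i j; rewrite !ord1; exact: xy.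
Qed.

Lemma boxE x e : box x e =
  [set y | forall i, `](x ord0 i - e), (x ord0 i + e)[%classic (y ord0 i)].
Proof.
by apply/seteqP; split => y /= xy i; have := xy i; rewrite /= in_itv/= ltr_distlC.
Qed.

Lemma measurable_box x e : measurable (box x e).
Proof.
rewrite boxE [X in measurable X](_ : _ = \bigcap_(i in [set: 'I_d])
    (rV_coord i @^-1` `](x ord0 i - e), (x ord0 i + e)[%classic)).
  apply: fin_bigcap_measurable => // i _; rewrite -[X in measurable X]setTI.
  exact: measurable_rV_coord.
by apply/seteqP; split => y /= xy i; [move=> _|]; exact: xy.
Qed.

Lemma lebesgue_rV_boxE x (e : R) : 0 < e ->
  lebesgue_rV d (box x e) = ((e *+ 2) ^+ d)%:E.
Proof.
move=> e0; rewrite boxE.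
rewrite (@lebesgue_rV_box R d (fun i => `](x ord0 i - e), (x ord0 i + e)[%classic))
  => [|i]; last exact: measurable_itv.
rewrite (eq_bigr (fun=> (e *+ 2)%:E)) => [|i _].
  by rewrite prodEFin prodr_const card_ord.
rewrite lebesgue_measure_itv/= lte_fin ltrD2l gtrN// -EFinD; congr (_%:E).
by rewrite opprB addrC addrA subrK mulr2n.
Qed.

(* Every open set is the union of the boxes with rational data it contains. *)
Lemma open_measurable_rV U : open U -> measurable U.
Proof.
move=> oU.
pose qbox (k : {ffun 'I_d -> rat} * nat) :=
  box (\row_i ratr (k.1 i)) (k.2.+1%:R^-1 : R).
pose F k := if pselect (qbox k `<=` U) then qbox k else set0.
have -> : U = \bigcup_k F k.
  apply/seteqP; split => [x Ux|x [k _]]; last first.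
    by rewrite /F; case: pselect => // kU; exact: kU.
  have [e e0 eU] := open_rV_box oU Ux.
  (* A rational centre within 1/(n+1) of x gives a box of that radius that contains x and, as
     2/(n+1) < e, lies in [box x e]. *)
  have [n ne] : exists n : nat, n.+1%:R^-1 < e / 2 :> R.
    have [n _ nE] := near_infty_natSinv_lt (PosNum (divr_gt0 e0 (ltr0Sn R 1))).
    by exists n; apply: (nE n) => /=.
  have n0 : 0 < n.+1%:R^-1 :> R by rewrite invr_gt0.
  have /choice[c cE] : forall i, exists q : rat,
      `|ratr q - x ord0 i| < n.+1%:R^-1.
    move=> i; have [|q] := @rat_in_itvoo R (x ord0 i - n.+1%:R^-1) (x ord0 i + n.+1%:R^-1).
      by rewrite ltrD2l gtrN.
    by rewrite in_itv/= => qE; exists q; rewrite distrC ltr_distlC.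
  exists ([ffun i => c i], n) => //; rewrite /F.
  have qx : qbox ([ffun i => c i], n) x by move=> i; rewrite mxE ffunE.
  case: pselect => [//|[]] y yq; apply: eU => i.
  have := qx i; have := yq i; rewrite /= mxE ffunE => h1 h2.
  rewrite (le_lt_trans (ler_distD (ratr (c i)) _ _))// [`|x ord0 i - _|]distrC.
  by rewrite (splitr e) ltrD// (lt_trans _ ne).
apply: countable_bigcupT_measurable => [|k]; first exact: countableP.
by rewrite /F; case: pselect => kU; [exact: measurable_box|exact: measurable0].
Qed.

Lemma open_continuous_measurable_rV U (f : 'rV[R]_d -> R) : open U ->
  {in U, continuous f} -> measurable_fun U f.
Proof.
move=> oU cf; apply: (measurability _ (RGenOpens.measurableE R)).
move=> _ [_ [a [b ->] <-]]; apply: open_measurable_rV.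
rewrite openE => x [Ux fx]; apply: filterI; first by apply: open_nbhs_nbhs.
have := cf x; rewrite inE => /(_ Ux); apply; apply: open_nbhs_nbhs; split => //.
Qed.

Lemma open_lebesgue_rV_gt0 U : open U -> U !=set0 -> (0 < lebesgue_rV d U)%E.
Proof.
move=> oU [x Ux]; have [e e0 eU] := open_rV_box oU Ux.
apply: (@lt_le_trans _ _ (lebesgue_rV d (box x e))).
  by rewrite lebesgue_rV_boxE// lte_fin exprn_gt0// pmulrn_lgt0.
apply: le_measure => //; rewrite inE; first exact: measurable_box.
exact: open_measurable_rV.
Qed.

Lemma bounded_lebesgue_rV_lty U : open U -> bounded_set U ->
  (lebesgue_rV d U < +oo)%E.
Proof.
(* [bounded_set] bounds the norm by every k > K, hence the 1 added here; the bound is not strict,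
   hence the radius k + 1 of the box. *)
move=> oU [K [_ bU]]; pose k := `|K| + 1.
have kK : K < k by rewrite (le_lt_trans (ler_norm K))// ltrDl.
have sub : U `<=` box 0 (k + 1).
  move=> x Ux i; rewrite mxE sub0r normrN.
  have /= := bU _ kK _ Ux; rewrite [X in X <= _]mx_normrE => xk.
  have := le_trans (le_bigmax _ (fun ij => `|x ij.1 ij.2|) (ord0, i)) xk.
  by move=> /= /le_lt_trans; apply; rewrite ltrDl.
apply: (@le_lt_trans _ _ (lebesgue_rV d (box 0 (k + 1)))).
  apply: le_measure => //; rewrite inE; last exact: measurable_box.
  exact: open_measurable_rV.
by rewrite lebesgue_rV_boxE ?ltry// ltr_wpDl// addr_ge0.
Qed.

End open_sets_rV.

(** * Integrals of bounded measurable functions on a bounded open set *)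

Section bounded_measurable.
Context {R : realType} {d : nat} (U : set 'rV[R]_d).
Hypotheses (oU : open U) (bU : bounded_set U).
Local Notation mu := (lebesgue_rV d).

(** A class stable under sums and products whose members are integrable on [U], which settles all
    integrability conditions at once. *)
Definition bdd_meas (f : 'rV[R]_d -> R) :=
  measurable_fun U f /\ exists C : R, forall x, U x -> `|f x| <= C.

Lemma bdd_measD f g : bdd_meas f -> bdd_meas g -> bdd_meas (fun x => f x + g x).
Proof.
move=> [mf [C fC]] [mg [C' gC']]; split; first exact: measurable_funD.
by exists (C + C') => x Ux; rewrite (le_trans (ler_normD _ _))// lerD ?fC ?gC'.
Qed.

Lemma bdd_measM f g : bdd_meas f -> bdd_meas g -> bdd_meas (fun x => f x * g x).
Proof.
move=> [mf [C fC]] [mg [C' gC']]; split; first exact: measurable_funM.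
by exists (C * C') => x Ux; rewrite normrM ler_pM ?fC ?gC'.
Qed.

Lemma bdd_meas_cst c : bdd_meas (fun=> c).
Proof. by split; [exact: measurable_cst|exists `|c|]. Qed.

Lemma bdd_meas_sum (I : Type) (r : seq I) (F : I -> 'rV[R]_d -> R) :
  (forall i, bdd_meas (F i)) -> bdd_meas (fun x => \sum_(i <- r) F i x).
Proof.
move=> bF; elim: r => [|i r IH].
  rewrite (_ : (fun x => _) = fun=> 0); first exact: bdd_meas_cst.
  by apply/funext => x; rewrite big_nil.
rewrite (_ : (fun x => _) = fun x => F i x + \sum_(i <- r) F i x).
  exact: bdd_measD.
by apply/funext => x; rewrite big_cons.
Qed.

Lemma eq_bdd_meas f g : (forall x, U x -> f x = g x) -> bdd_meas f -> bdd_meas g.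
Proof.
move=> fg [mf [C fC]]; split; last by exists C => x Ux; rewrite -fg ?fC.
by apply: eq_measurable_fun mf => x; rewrite inE; exact: fg.
Qed.

Lemma bdd_meas_integrable f : bdd_meas f -> mu.-integrable U (EFin \o f).
Proof.
move=> [mf [C fC]]; apply: measurable_bounded_integrable => //.
- exact: open_measurable_rV.
- exact: bounded_lebesgue_rV_lty.
- exists C; split; first exact: num_real.
  by move=> M CM x Ux /=; rewrite (le_trans (fC _ Ux))// ltW.
Qed.

Lemma Rintegral_lin_sum (I : Type) (r : seq I) (c : I -> R) (F : I -> 'rV[R]_d -> R) :
  (forall i, bdd_meas (F i)) ->
  Rintegral mu U (fun x => \sum_(i <- r) c i * F i x) =
  \sum_(i <- r) c i * Rintegral mu U (F i).
Proof.
move=> bF; have mU := open_measurable_rV oU.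
have bcF i : bdd_meas (fun x => c i * F i x).
  by apply: bdd_measM => //; exact: bdd_meas_cst.
elim: r => [|i r IH].
  rewrite big_nil (_ : (fun x => _) = fun=> 0).
    by rewrite Rintegral_cst// mul0r.
  by apply/funext => x; rewrite big_nil.
rewrite big_cons -IH -RintegralZl//; last exact: bdd_meas_integrable.
rewrite -RintegralD//.
- by apply: eq_Rintegral => x _; rewrite big_cons.
- exact: bdd_meas_integrable.
- by apply: bdd_meas_integrable; exact: bdd_meas_sum.
Qed.

Lemma qform_gram_integral N (F : 'I_N -> 'I_N -> 'rV[R]_d -> R) (x : 'cV[R]_N) :
  (forall k j, bdd_meas (F k j)) ->
  qform (\matrix_(k, j) Rintegral mu U (F k j)) x =
  Rintegral mu U (fun y => \sum_k \sum_j x k 0 * x j 0 * F k j y).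
Proof.
move=> bF; under eq_Rintegral => y _ do rewrite pair_big/=.
rewrite (@Rintegral_lin_sum _ _ (fun kj => x kj.1 0 * x kj.2 0)
  (fun kj => F kj.1 kj.2))// -(pair_big xpredT xpredT
  (fun k j => x k 0 * x j 0 * Rintegral mu U (F k j)))/=.
rewrite /qform mxE exchange_big/=; apply: eq_bigr => j _.
rewrite mxE big_distrl/=; apply: eq_bigr => k _; rewrite !mxE; ring.
Qed.

Lemma Rintegral_sqr_gt0 f x0 : {in U, continuous f} -> bdd_meas f ->
  U x0 -> f x0 != 0 -> 0 < Rintegral mu U (fun x => f x * f x).
Proof.
move=> cf bf Ux0 fx0; have mU := open_measurable_rV oU.
have bff := bdd_measM bf bf.
(* By continuity |f| > c on an open neighbourhood of x0 in [U]; this set has positive measure and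
   the integral is at least c^2 times it. *)
pose c := `|f x0| / 2; have c0 : 0 < c by rewrite divr_gt0// normr_gt0.
pose V := U `&` [set x | c < `|f x|].
have oV : open V.
  rewrite openE => x [Ux /= cfx]; apply: filterI; first exact: open_nbhs_nbhs.
  have : f @ x --> f x by exact: (cf x (mem_set Ux)).
  by move=> /cvg_norm h; exact: (cvgr_gt _ h).
have V0 : V !=set0.
  by exists x0; split => //=; rewrite /c ltr_pdivrMr// ltr_pMr ?normr_gt0// ltr1n.
have mV := open_measurable_rV oV.
have If := bdd_meas_integrable bff.
have : ((c * c)%:E * mu V <= \int[mu]_(x in U) (f x * f x)%:E)%E.
  rewrite -integral_cst//.
  apply: (@le_trans _ _ (\int[mu]_(x in V) (f x * f x)%:E)%E).
    apply: ge0_le_integral => //.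
    - by move=> x _; rewrite lee_fin mulr_ge0 ?ltW.
    - apply: (measurable_funS mU); first by move=> x [].
      by case/integrableP : If.
    - move=> x [Ux /= cfx]; rewrite lee_fin.
      by rewrite -[leRHS]ger0_norm ?normrM ?ler_pM ?(ltW c0) ?(ltW cfx)// -expr2 sqr_ge0.
  apply: ge0_subset_integral => //.
  - by case/integrableP : If.
  - by move=> x _; rewrite lee_fin -expr2 sqr_ge0.
  - by move=> x [].
rewrite -[X in (_ <= X)%E]fineK; last exact: integrable_fin_num.
move=> h; rewrite /Rintegral -lte_fin; apply: lt_le_trans h.
apply: mule_gt0; first by rewrite lte_fin mulr_gt0.
exact: open_lebesgue_rV_gt0.
Qed.

End bounded_measurable.

(** * Mass and stiffness matrices *)

Section piecewise_affine.
Context {R : realType} {d : nat} (Omega : set 'rV[R]_d).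
Context (nv : nat) (vert : 'I_nv -> 'rV[R]_d) (elts : {set {set 'I_nv}}).
Implicit Types (v x : 'rV[R]_d) (h : R).

Lemma vhull_segment (e : {set 'I_nv}) v x (p h q : R) : p <= h -> h <= q ->
  vhull vert e (p *: v + x) -> vhull vert e (q *: v + x) ->
  vhull vert e (h *: v + x).
Proof.
move=> ph hq [c [c0 ce c1 cE]] [c' [c'0 c'e c'1 c'E]].
have [pq|pq] := eqVneq p q.
  have -> : h = p by apply/eqP; rewrite eq_le ph pq hq.
  by exists c.
have {}pq : 0 < q - p by rewrite subr_gt0 lt_neqAle pq (le_trans ph).
pose s := (h - p) / (q - p).
have s0 : 0 <= s by rewrite divr_ge0 ?(ltW pq)// subr_ge0.
have s1 : 0 <= 1 - s by rewrite subr_ge0 ler_pdivrMr// mul1r lerD2r.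
exists (fun i => (1 - s) * c i + s * c' i); split.
- by move=> i; rewrite addr_ge0// mulr_ge0.
- by move=> i ie; rewrite ce// c'e// !mulr0 addr0.
- by rewrite big_split/= -!big_distrr/= c1 c'1 !mulr1 subrK.
under eq_bigr do rewrite scalerDl -!scalerA.
rewrite big_split/= -!scaler_sumr -cE -c'E !scalerDr !scalerA addrACA.
rewrite -!scalerDl subrK scale1r; congr (_ *: _ + _).
by rewrite /s; field; rewrite gt_eqF.
Qed.

Lemma vhull_vert (e : {set 'I_nv}) i : i \in e -> vhull vert e (vert i).
Proof.
move=> ie; exists (fun j => (j == i)%:R); split=> [j|j||].
- exact: ler0n.
- by case: eqVneq => // -> /negP.
- by rewrite (bigD1 i)//= eqxx big1 ?addr0// => j /negbTE ->.
rewrite (bigD1 i)//= eqxx scale1r big1 ?addr0// => j /negbTE ->.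
by rewrite scale0r.
Qed.

(** An affine function takes at x the convex combination of its vertex values with the barycentric
    coefficients of x. *)
Lemma affine_on_vhull_norm_le (e : {set 'I_nv}) (f : 'rV[R]_d -> R) C x :
  affine_on (vhull vert e) f -> (forall i, `|f (vert i)| <= C) ->
  vhull vert e x -> `|f x| <= C.
Proof.
move=> [a [b fE]] fC ex; rewrite fE//; have [c [c0 ce c1 ->]] := ex.
have -> : ((\sum_i c i *: vert i) *m a) 0 0 + b = \sum_i c i * f (vert i).
  rewrite mulmx_suml summxE -[b]mul1r -c1 big_distrl/= -big_split/=.
  apply: eq_bigr => i _; rewrite -scalemxAl mxE -mulrDr.
  have [ie|ie] := boolP (i \in e); last by rewrite ce// !mul0r.
  by rewrite fE//; exact: vhull_vert.
apply: (le_trans (ler_norm_sum _ _ _)); rewrite -[leRHS]mul1r -c1 big_distrl/=.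
by apply: ler_sum => i _; rewrite normrM ger0_norm// ler_wpM2l.
Qed.

Hypotheses (oOmega : open Omega).
Hypothesis cover : forall x, Omega x -> exists2 e, e \in elts & vhull vert e x.

Lemma ray_cvg v x : h *: v + x @[h --> (0 : R)] --> x.
Proof.
rewrite -[X in _ --> X]add0r -(scale0r v).
by apply: cvgD; [exact: scalel_continuous|exact: cvg_cst].
Qed.

Lemma ray_near v x : Omega x -> \forall h \near (0 : R), Omega (h *: v + x).
Proof. by move=> Ox; apply: (@ray_cvg v x Omega); exact: open_nbhs_nbhs. Qed.

Lemma ray_element v x : Omega x -> exists2 e, e \in elts &
  exists2 delta : R, 0 < delta &
    forall h, 0 < h -> h <= delta -> vhull vert e (h *: v + x).
Proof.
move=> /(ray_near v)/nbhs_ballP[r /= r0 rO].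
(* The denominator n + 2 keeps t_n strictly below r already for n = 0. *)
pose t n : R := r / n.+2%:R.
have t0 n : 0 < t n by rewrite divr_gt0.
have tO n : Omega (t n *: v + x).
  apply: rO; rewrite /ball/= sub0r normrN gtr0_norm//.
  by rewrite ltr_pdivrMr// ltr_pMr// ltr1n.
have tle m n : (m <= n)%N -> t n <= t m.
  by move=> mn; rewrite ler_pM2l// lef_pV2 ?posrE// ler_nat.
have [e ee freq] : exists2 e, e \in elts &
    forall n, exists2 m, (n <= m)%N & vhull vert e (t m *: v + x).
  apply: contrapT => /forall2NP H.
  (* If each element missed all t_n from some index [nf e] on, the point at the maximum of these
     indices would lie in no element. *)
  have /choice[nf nfE] : forall e : {set 'I_nv}, exists n, e \in elts ->
      forall m, (n <= m)%N -> ~ vhull vert e (t m *: v + x).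
    move=> e; have [He|/existsNP[n /forall2NP Hn]] := H e; first by exists 0%N.
    exists n => _ m nm; by have [|] := Hn m.
  have [e ee eE] := cover (tO (\max_e nf e)).
  by apply: (nfE e ee _ _ eE); exact: leq_bigmax.
exists e => //; have [m0 _ m0E] := freq 0%N; exists (t m0) => // h h0 hm0.
have [n nh] : exists n : nat, t n <= h.
  have [n _ nE] := near_infty_natSinv_lt (PosNum (divr_gt0 h0 r0)).
  exists n; rewrite /t -ler_pdivlMl// mulrC.
  rewrite (le_trans _ (ltW (nE n _)))//= lef_pV2 ?posrE// ler_nat//.
have [m nm mE] := freq n.
by apply: (vhull_segment _ hm0 mE m0E); rewrite (le_trans (tle _ _ nm)).
Qed.

Context (f : 'rV[R]_d -> R).
Hypothesis cf : {in Omega, continuous f}.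
Hypothesis af : forall e, e \in elts -> affine_on (vhull vert e) f.

(** Exact affinity on a short ray, stronger than a one-sided derivative: difference quotients become
    constant, so limits are immediate. *)
Definition right_slope v x (g : R) := exists2 delta : R, 0 < delta &
  forall h, 0 < h -> h <= delta -> f (h *: v + x) = f x + h * g.

Lemma right_slope_exists v : exists C : R, forall x, Omega x ->
  exists2 g, `|g| <= C & right_slope v x g.
Proof.
have /choice[ab abE] : forall e : {set 'I_nv}, exists ab : 'cV[R]_d * R,
    e \in elts -> forall x, vhull vert e x -> f x = (x *m ab.1) 0 0 + ab.2.
  move=> e; have [ee|ee] := boolP (e \in elts); last by exists (0, 0).
  by have [a [b H]] := af ee; exists (a, b).
(* Summing over all elements makes the bound independent of the element that carries the ray. *)
exists (\sum_e `|(v *m (ab e).1) 0 0|) => x Ox.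
have [e ee [delta delta0 eE]] := ray_element v Ox.
pose g := (v *m (ab e).1) 0 0; pose K := (x *m (ab e).1) 0 0 + (ab e).2.
have fE h : 0 < h -> h <= delta -> f (h *: v + x) = K + h * g.
  move=> h0 hd; rewrite (abE _ ee _ (eE _ h0 hd)) mulmxDl -scalemxAl.
  by rewrite /K /g !mxE; ring.
(* The element is only known to contain points with h > 0; continuity of [f] recovers the value at x
   as a limit from the right. *)
have fx : f x = K.
  have l1 : f (h *: v + x) @[h --> (0 : R)^'+] --> f x.
    apply: cvg_at_right_filter; apply: (cvg_comp _ _ (@ray_cvg v x)).
    exact: (cf (mem_set Ox)).
  have l2 : f (h *: v + x) @[h --> (0 : R)^'+] --> K.
    have l3 : K + h * g @[h --> (0 : R)^'+] --> K.
      rewrite [X in _ --> X](_ : K = K + 0 * g); last by rewrite mul0r addr0.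
      apply: cvg_at_right_filter; apply: cvgD; first exact: cvg_cst.
      by apply: cvgM; [exact: cvg_id|exact: cvg_cst].
    apply: cvg_trans l3; apply: near_eq_cvg; near=> h.
    by apply/esym/fE; near: h; [exact: nbhs_right_gt|exact: nbhs_right_le].
  exact: (cvg_unique _ l1 l2).
exists g; first by rewrite /g (bigD1 e)//= lerDl sumr_ge0.
by exists delta => // h h0 hd; rewrite fE// fx.
Unshelve. all: by end_near. Qed.

Lemma right_slope_measurable v (g : 'rV[R]_d -> R) :
  (forall x, Omega x -> right_slope v x (g x)) -> measurable_fun Omega g.
Proof.
move=> gE; have mO := open_measurable_rV oOmega.
have mf : measurable_fun Omega f by exact: open_continuous_measurable_rV.
pose t n : R := n.+1%:R^-1.
(* The slope is the limit of difference quotients with steps 1/(n+1), eventually constant at each x.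
   Extending [f] by 0 outside [Omega] makes the shifted function measurable even where the shift
   leaves the domain. *)
apply: (@measurable_fun_cvg _ _ _ Omega
  (fun n x => n.+1%:R * ((f \_ Omega) (t n *: v + x) - f x))).
  move=> n; apply: measurable_funM; first exact: measurable_cst.
  apply: measurable_funB => //; apply: measurable_funTS.
  apply: (@measurableT_comp _ _ _ _ _ _ (f \_ Omega)).
    by apply/(measurable_restrictT _ mO).
  apply: measurable_fun_rVP => i.
  rewrite (_ : _ \o _ = fun x => t n * v ord0 i + rV_coord i x).
    by apply: measurable_funD; [exact: measurable_cst|exact: measurable_rV_coord].
  by apply/funext => x /=; rewrite /rV_coord !mxE.
move=> x Ox; apply: cvg_near_cst.
have [delta delta0 dE] := gE x Ox.
have /nbhs_ballP[r /= r0 rO] := ray_near v Ox.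
near=> n.
have tn0 : 0 < t n by rewrite invr_gt0.
have tr : t n < r by near: n; exact: (near_infty_natSinv_lt (PosNum r0)).
have td : t n < delta by near: n; exact: (near_infty_natSinv_lt (PosNum delta0)).
have tO : Omega (t n *: v + x).
  by apply: rO; rewrite /ball/= sub0r normrN gtr0_norm.
rewrite patchE mem_set// dE ?(ltW td)// addrAC subrr add0r mulrA divff ?mul1r//.
Unshelve. all: by end_near. Qed.

(** The quotient is gp for small h > 0 and - gm for small h < 0. It converges exactly when these
    agree; otherwise [lim] returns its default [point]. *)
Lemma derive_right_slopes v x gp gm : right_slope v x gp ->
  right_slope (- v) x gm -> 'D_v f x = if gp == - gm then gp else point.
Proof.
move=> [dp dp0 dpE] [dm dm0 dmE]; rewrite /derive.
set q := (X in lim (X @ _)).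
have qp h : 0 < h -> h <= dp -> q h = gp.
  move=> h0 hdp; rewrite /q /= dpE// addrAC subrr add0r /GRing.scale/= mulrA.
  by rewrite mulVf ?mul1r// gt_eqF.
have qm h : h < 0 -> - h <= dm -> q h = - gm.
  move=> h0 hdm; rewrite /q /= -[h *: v]opprK -scaleNr -scalerN dmE ?oppr_gt0//.
  rewrite addrAC subrr add0r /GRing.scale/= mulNr mulrN mulrA mulVf ?mul1r//.
  by rewrite lt_eqF.
case: eqP => [e|ne].
  apply: cvg_lim => //; apply: cvg_near_cst; near=> h.
  have : h != 0 by near: h; exact: nbhs_dnbhs_neq.
  have hp : `|h| < dp by near: h; exact: dnbhs0_lt.
  have hm : `|h| < dm by near: h; exact: dnbhs0_lt.
  case: ltgtP => // h0 _.
    by rewrite e qm// -ltr0_norm// ltW.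
  by rewrite qp// -[h]gtr0_norm// ltW.
have cp : q h @[h --> (0 : R)^'+] --> gp.
  apply: cvg_near_cst; near=> h; apply: qp; near: h; first exact: nbhs_right_gt.
  exact: nbhs_right_le.
have cm : q h @[h --> (0 : R)^'-] --> - gm.
  apply: cvg_near_cst; near=> h; apply: qm; first by near: h; exact: nbhs_left_lt.
  by rewrite lerNl; near: h; apply: nbhs_left_ge; rewrite oppr_lt0.
apply: xgetPN => l ql; apply: ne.
have lp := cvg_dnbhs_at_right ql; have lm := cvg_dnbhs_at_left ql.
exact: etrans (cvg_unique _ cp lp) (esym (cvg_unique _ cm lm)).
Unshelve. all: by end_near. Qed.

Lemma derive_bdd_meas v : bdd_meas Omega (fun x => 'D_v f x).
Proof.
have slope_fun w : exists C : R, exists g : 'rV[R]_d -> R, forall x, Omega x ->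
    `|g x| <= C /\ right_slope w x (g x).
  have [C H] := right_slope_exists w; exists C.
  have /choice[g gE] : forall x, exists g, Omega x -> `|g| <= C /\ right_slope w x g.
    move=> x; have [Ox|nOx] := pselect (Omega x); last by exists 0.
    by have [g gC sg] := H x Ox; exists g.
  by exists g.
have [C [gp gpE]] := slope_fun v; have [C' [gm gmE]] := slope_fun (- v).
have mp : measurable_fun Omega gp.
  by apply: (@right_slope_measurable v) => x /gpE[].
have mm : measurable_fun Omega gm.
  by apply: (@right_slope_measurable (- v)) => x /gmE[].
have mO := open_measurable_rV oOmega.
(* Default included, the derivative is a measurable function of the two bounded slopes. *)
apply: (@eq_bdd_meas _ _ _ (fun x => if gp x == - gm x then gp x else point)).
  by move=> x Ox; rewrite (@derive_right_slopes v x (gp x) (gm x))//;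
    [have [] := gpE x Ox|have [] := gmE x Ox].
split; last first.
  exists (`|C| + `|point : R|) => x Ox; case: eqP => _; last by rewrite lerDr.
  have [gC _] := gpE x Ox; rewrite (le_trans gC)// (le_trans (ler_norm C))//.
  by rewrite lerDl.
apply: measurable_fun_if => //.
- apply: measurable_fun_eqr => //; exact: measurableT_comp.
- by apply: measurable_funS mp => // x [].
Qed.

End piecewise_affine.

Lemma cvg_lin_comb (R : realType) (T : topologicalType) (I : Type) (r : seq I)
    (c : I -> R) (F : I -> T -> R) (y : T) :
  (forall i, F i z @[z --> y] --> F i y) ->
  \sum_(i <- r) c i * F i z @[z --> y] --> \sum_(i <- r) c i * F i y.
Proof.
move=> cF; apply: cvg_big => [|i _]; first exact: add_continuous.
by apply: cvgM; [exact: cvg_cst|exact: cF].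
Qed.

(** * Definiteness of the mass and stiffness matrices *)

Section finite_element_matrices.
Context {R : realType} {d : nat} (Omega : set 'rV[R]_d).
Context (nv : nat) (vert : 'I_nv -> 'rV[R]_d) (elts : {set {set 'I_nv}}).
Context (N : nat) (iv : 'I_N -> 'I_nv) (phi : 'I_N -> 'rV[R]_d -> R).
Hypotheses (hOmega : bounded_domain Omega) (hmesh : simplicial_mesh Omega vert elts).
Hypotheses (hiv : interior_numbering Omega vert iv).
Hypotheses (hphi : nodal_basis Omega vert elts iv phi).

Let oO : open Omega. Proof. by case: hOmega. Qed.
Let bO : bounded_set Omega. Proof. by case: hOmega. Qed.

Let cover x : Omega x -> exists2 e, e \in elts & vhull vert e x.
Proof.
move=> Ox; have [_ _ _ clE _] := hmesh.
have : closure Omega x by exact: subset_closure.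
by rewrite clE => -[e ee ex]; exists e.
Qed.

Let phi_continuous k : {in Omega, continuous (phi k)}.
Proof.
have [ck _ _] := hphi k; rewrite -(continuous_open_subspace _ oO).
exact: continuous_subspaceW (@subset_closure _ Omega) ck.
Qed.

Let phi_bdd_meas k : bdd_meas Omega (phi k).
Proof.
have [_ ak vk] := hphi k; split; first exact: open_continuous_measurable_rV.
exists 1 => x Ox; have [e ee ex] := cover Ox.
apply: affine_on_vhull_norm_le ex; first exact: ak.
by move=> i; rewrite vk; case: (_ == _); rewrite ?normr1 ?normr0.
Qed.

Lemma mass_matrix_spd : spd (mass_matrix Omega phi).
Proof.
split.
  apply/matrixP => k j; rewrite !mxE; apply: eq_Rintegral => x _.
  exact: mulrC.
move=> x x0; rewrite -/(qform _ x) (qform_gram_integral oO bO); last first.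
  by move=> k j; exact: bdd_measM.
have /matrix0Pn[k [j]] := x0; rewrite ord1 => xk {j}.
pose f y := \sum_k x k 0 * phi k y.
have -> : Rintegral (lebesgue_rV d) Omega
    (fun y => \sum_k \sum_j x k 0 * x j 0 * (phi k y * phi j y)) =
    Rintegral (lebesgue_rV d) Omega (fun y => f y * f y).
  apply: eq_Rintegral => y _; rewrite /f big_distrl/=; apply: eq_bigr => i _.
  by rewrite big_distrr/=; apply: eq_bigr => j _; ring.
(* At the interior vertex of index k the combination [f] takes the value x_k, which is nonzero. *)
have Ok : Omega (vert (iv k)) by have [_ H] := hiv; apply/H; exists k.
apply: (@Rintegral_sqr_gt0 _ _ _ oO bO f (vert (iv k))) => //.
- move=> y Oy; apply: (@cvg_lin_comb R _ _ _ (fun k => x k 0) phi y) => i.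
  exact: phi_continuous.
- by apply: bdd_meas_sum => i; apply: bdd_measM => //; exact: bdd_meas_cst.
rewrite /f (bigD1 k)//= big1 => [|i ik].
  by have [_ _ ->] := hphi k; rewrite eqxx mulr1 addr0.
have [_ _ ->] := hphi i; have [iv_inj _] := hiv.
by rewrite (inj_eq iv_inj) eq_sym (negbTE ik) mulr0.
Qed.

Context (D : 'rV[R]_d -> 'M[R]_d) (dmin dmax : R).
Hypothesis hD : diffusion Omega D dmin dmax.

(** Polarisation: 4 D_ij is the difference of the forms at u_i + u_j and u_i - u_j. Both vectors
    have norm at most 2, so both forms lie in [0, 4 dmax] and |D_ij| <= dmax. *)
Let D_bdd_meas i j : bdd_meas Omega (fun x => D x i j).
Proof.
have [dmin0 dmax0 mD DE] := hD; split => //.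
exists dmax => x Ox; have [Ds lo hi] := DE x Ox.
pose u a : 'cV[R]_d := delta_mx a 0.
have uDu a b : ((u a)^T *m D x *m u b) 0 0 = D x a b.
  by rewrite /u trmx_delta -rowE -colE !mxE.
have bnd y : 0 <= qform (D x) y <= dmax * qform 1%:M y.
  rewrite -qform_scalar (hi y) andbT (le_trans _ (lo y))//.
  by rewrite -/(qform _ y) qform_scalar mulr_ge0 ?qform1_ge0// ltW.
have qN y : qform 1%:M (- y) = qform 1%:M y.
  by rewrite !qform1E; apply: eq_bigr => k _; rewrite mxE sqrrN.
have q1 a : qform 1%:M (u a) <= 1 ^+ 2.
  rewrite /qform mulmx1 /u trmx_delta mul_delta_mx mxE !eqxx.
  by rewrite expr1n.
have polar : qform (D x) (u i + u j) - qform (D x) (u i - u j) = 4 * D x i j.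
  have exp (s : R) : qform (D x) (u i + s *: u j) =
      D x i i + s * D x j i + (s * D x i j + s * (s * D x j j)).
    rewrite /qform; have -> : (u i + s *: u j)^T = (u i)^T + s *: (u j)^T.
      by rewrite linearD/= linearZ.
    rewrite mulmxDl !mulmxDr !mulmxDl -!scalemxAr -!scalemxAl.
    by rewrite -!uDu !mxE.
  have := exp 1; have := exp (-1); rewrite scale1r scaleN1r => -> ->.
  have -> : D x j i = D x i j by rewrite -{1}Ds mxE.
  by ring.
have /andP[p0 p4] := bnd (u i + u j); have /andP[m0 m4] := bnd (u i - u j).
have n1 := qform1_add ler01 ler01 (q1 i) (q1 j).
have n2 : qform 1%:M (u i - u j) <= (1 + 1) ^+ 2.
  by apply: qform1_add => //; rewrite qN.
have p4' := le_trans p4 (ler_wpM2l (ltW dmax0) n1).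
have m4' := le_trans m4 (ler_wpM2l (ltW dmax0) n2).
by rewrite ler_norml; apply/andP; split; lra.
Qed.

Let grad_bdd_meas k i : bdd_meas Omega (fun x => grad (phi k) x ord0 i).
Proof.
have [_ ak _] := hphi k.
apply: eq_bdd_meas (derive_bdd_meas oO cover (@phi_continuous k) ak (delta_mx ord0 i)).
by move=> x _; rewrite mxE.
Qed.

Lemma stiffness_matrix_psd : psd (stiffness_matrix Omega D phi).
Proof.
have [dmin0 dmax0 mD DE] := hD; split.
  apply/matrixP => k j; rewrite !mxE; apply: eq_Rintegral => x.
  rewrite inE => /DE[Ds _ _]; rewrite -[in LHS]Ds.
  have tr11 (X : 'M[R]_1) : X^T 0 0 = X 0 0 by rewrite mxE.
  by rewrite -tr11 !trmx_mul !trmxK mulmxA.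
move=> x; rewrite (qform_gram_integral oO bO) => [|k j]; last first.
  apply: (@eq_bdd_meas _ _ _ (fun y => \sum_i (\sum_l grad (phi k) y ord0 l * D y l i)
    * grad (phi j) y ord0 i)).
    by move=> y _; rewrite mxE; apply: eq_bigr => i _; rewrite !mxE.
  apply: bdd_meas_sum => i; apply: bdd_measM => //.
  by apply: bdd_meas_sum => l; exact: bdd_measM.
apply: Rintegral_ge0 => y /DE[_ lo _].
pose w := \sum_k x k 0 *: grad (phi k) y.
(* The integrand is the form of D at the combined gradient w, hence at least dmin |w|^2. *)
have -> : \sum_k \sum_j x k 0 * x j 0 *
    (grad (phi k) y *m D y *m (grad (phi j) y)^T) 0 0 = qform (D y) w^T.
  rewrite /qform trmxK /w linear_sum/= !mulmx_suml summxE; apply: eq_bigr => k _.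
  rewrite mulmx_sumr summxE; apply: eq_bigr => j _.
  by rewrite linearZ/= -!scalemxAl -scalemxAr !mxE mulrA.
apply: le_trans (lo _); rewrite -/(qform _ _) qform_scalar mulr_ge0 ?qform1_ge0//.
exact: ltW.
Qed.

End finite_element_matrices.

(** * Conditioning of the implicit Runge-Kutta integration *)

Unset Implicit Arguments.
Set Strict Implicit.

Theorem theorem5p2 (R : realType) (d : nat) (hd : (0 < d)%N)
    (Omega : set 'rV[R]_d) (hOmega : bounded_domain Omega)
    (nv : nat) (vert : 'I_nv -> 'rV[R]_d) (elts : {set {set 'I_nv}})
    (hmesh : simplicial_mesh Omega vert elts)
    (N : nat) (hN : (0 < N)%N) (iv : 'I_N -> 'I_nv)
    (hiv : interior_numbering Omega vert iv)
    (phi : 'I_N -> 'rV[R]_d -> R) (hphi : nodal_basis Omega vert elts iv phi)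
    (D : 'rV[R]_d -> 'M[R]_d) (dmin dmax : R) (hD : diffusion Omega D dmin dmax)
    (M A : 'M[R]_N) (hM : M = mass_matrix Omega phi)
    (hA : A = stiffness_matrix Omega D phi)
    (dt : R) (hdt : 0 < dt)
    (s : nat) (Gamma : 'M[R]_s)
    (hGamma : forall z : R[i],
      eigenvalue (map_mx (real_complex R) Gamma) z -> 0 <= complex.Re z)
    (T : 'M[R]_s) (p : nat) (B : 'I_p -> jordan_block R)
    (hs : (\sum_(q < p) jb_len (B q) * jb_dim (B q))%N = s)
    (hJ : real_jordan_form Gamma T hs) :
  (* the mu_j and alpha_j +- i beta_j are the real and complex eigenvalues *)
  [/\ (forall x : R, eigenvalue Gamma x <-> exists q m, B q = RealBlock x m),
      (forall z : R[i], complex.Im z != 0 ->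
        (eigenvalue (map_mx (real_complex R) Gamma) z <->
         exists q alpha beta m, B q = CplxBlock alpha beta m /\
           (z = alpha +i* beta \/ z = alpha +i* (- beta)))),
  (* the stage system amounts to the smaller systems *)
      [/\ transformed_stage_mx M A dt Gamma T = stage_mx M A dt (jordan_mx hs),
          (forall (u : 'cV[R]_N) (v : 'I_s -> 'cV[R]_N),
            stage_system M A dt Gamma u v <->
            jordan_substitution M A dt T hs u v),
          (forall q mu m, B q = RealBlock mu m -> spd (M + (mu * dt) *: A)),
          (forall q alpha beta m, B q = CplxBlock alpha beta m ->
            posdef (sym_part (1%:M *t M + dt *: (rot_mx alpha beta *t A))))
        & rk_conditioning M A dt Gamma T hs =
          \big[Num.max/0]_(q < p) block_cond M A dt (B q)]
  (* the bound for the preconditioned systems *)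
    & forall P : 'M[R]_N, spd P ->
      forall q alpha beta m, B q = CplxBlock alpha beta m ->
      let Q := mx_invsqrt P in
      let PB := ((1%:M : 'M[R]_2) *t Q)
                *m (1%:M *t M + dt *: (rot_mx alpha beta *t A))
                *m (1%:M *t Q) in
      posdef (sym_part PB) /\
      cond_tilde PB <=
        (lambda_max (Q *m M *m Q)
         + dt * Num.sqrt (alpha ^+ 2 + beta ^+ 2) * lambda_max (Q *m A *m Q))
        / (lambda_min (Q *m M *m Q) + dt * alpha * lambda_min (Q *m A *m Q))].
Proof.
have Mspd : spd M by rewrite hM; exact: (mass_matrix_spd hOmega hmesh hiv hphi).
have Apsd : psd A by rewrite hA; exact: (stiffness_matrix_psd hOmega hmesh hphi hD).
have evP z := jordan_form_eigenvalue z hJ.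
have [Tu beta_neq0 GE] := hJ.
(* Each Jordan block contributes the eigenvalues of its core to [Gamma], so the assumption on real
   parts yields mu >= 0 and alpha >= 0. *)
have mu_ge0 q mu m : B q = RealBlock mu m -> 0 <= mu.
  by move=> Bq; apply: (hGamma mu%:C); apply/evP; exists q; rewrite Bq.
have alpha_ge0 q alpha beta m : B q = CplxBlock alpha beta m -> 0 <= alpha.
  move=> Bq; apply: (hGamma (alpha +i* beta)); apply/evP; exists q.
  by rewrite Bq; left.
split.
- move=> x; have -> : eigenvalue Gamma x =
      eigenvalue (map_mx (real_complex R) Gamma) x%:C.
    by rewrite !eigenvalue_root_char -map_char_poly/= fmorph_root.
  rewrite evP; split=> [[q]|[q [m Bq]]]; last by exists q; rewrite Bq.
  case Bq : (B q) => [mu m|alpha beta m] /=; first by move=> [->]; exists q, m.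
  (* A nonzero beta keeps the eigenvalues of a complex block off the real axis. *)
  have b0 := beta_neq0 _ _ _ _ Bq.
  case=> [[_ b]|[_ b]]; first by rewrite -b eqxx in b0.
  by move/eqP: b; rewrite eq_sym oppr_eq0 (negbTE b0).
- move=> z Imz; rewrite evP; split=> [[q]|[q [alpha [beta [m [Bq zE]]]]]]; last first.
    by exists q; rewrite Bq.
  case Bq : (B q) => [mu m|alpha beta m] /=.
    by move=> zE; rewrite zE/= eqxx in Imz.
  by move=> zE; exists q, alpha, beta, m.
- split.
  + by rewrite GE transformed_stage_mxE.
  + by move=> u v; exact: jordan_substitutionP.
  + move=> q mu m Bq; have [Ms M0] := Mspd; have [As A0] := Apsd.
    split; first by rewrite linearD/= linearZ/= Ms As.
    move=> x x0; rewrite -/(qform _ x) qformD qformZ ltr_pwDl//; first exact: M0.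
    by rewrite mulr_ge0// mulr_ge0 ?(mu_ge0 _ _ _ Bq)// ltW.
  + move=> q alpha beta m Bq.
    exact: (cplx_coef_posdef beta hN Mspd Apsd (ltW hdt) (alpha_ge0 _ _ _ _ Bq)).
  + exact: rk_conditioningE.
- move=> P Pspd q alpha beta m Bq Q PB.
  have Qspd : spd Q by exact: mx_invsqrt_spd.
  (* The general estimates now apply with Q M Q and Q A Q in place of [M] and [A]. *)
  have -> : PB = cplx_coef (Q *m M *m Q) (Q *m A *m Q) dt alpha beta.
    exact: cplx_coef_congr.
  have M'spd := spd_congr Qspd Mspd.
  have A'psd : psd (Q *m A *m Q) by apply: psd_congr => //; case: Qspd.
  have a0 := alpha_ge0 _ _ _ _ Bq.
  split; first exact: (cplx_coef_posdef beta hN M'spd A'psd (ltW hdt) a0).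
  exact: (cplx_coef_cond_le beta hN M'spd A'psd (ltW hdt) a0).
Qed.
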